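(* Let $(X,f)$ be a topological dynamical system, i.e. $X$ is a compact metric space and $f:X\to X$ is continuous. Then: (1) For any $x\in X$, $\omega_{\underline d}(x)=\bigcap_{\mu\in V_f(x)}S_\mu$. (2) For any $x\in X$, $\omega_{\overline d}(x)=\overline{\bigcup_{\mu\in V_f(x)}S_\mu}\neq\emptyset$. (3) For any $x\in X$, $\omega_{\underline B}(x)=\bigcap_{\mu\in V_f^*(x)}S_\mu=\bigcap_{\mu\in M(f,\omega_f(x))}S_\mu=\bigcap_{\mu\in M_{erg}(f,\omega_f(x))}S_\mu$. If $\omega_{\underline B}(x)\neq\emptyset$, then $\omega_{\underline B}(x)$ is minimal. (4) For any $x\in X$, $\omega_{\overline B}(x)=\overline{\bigcup_{\mu\in V_f^*(x)}S_\mu}=\overline{\bigcup_{\mu\in M(f,\omega_f(x))}S_\mu}=\overline{\bigcup_{\mu\in M_{erg}(f,\omega_f(x))}S_\mu}\neq\emptyset$. (5) For any $f$-invariant Borel probability measure $\mu$ and $\mu$-a.e. $x\in X$, $\omega_{\underline d}(x)=\omega_{\overline d}(x)=\omega_{\overline B}(x)=\omega_f(x)=\overline{\operatorname{orb}(x,f)}$. If further $\mu$ is ergodic, then for $\mu$-a.e. $x\in X$, $\omega_{\underline d}(x)=\omega_{\overline d}(x)=\omega_{\overline B}(x)=\omega_f(x)=\overline{\operatorname{orb}(x,f)}=S_\mu$.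
   Context: $\operatorname{orb}(x,f)=\{f^n(x)\}_{n\ge0}$, $\omega_f(x)=\bigcap_{n\ge1}\overline{\bigcup_{k\ge n}\{f^k(x)\}}$, $B(y,\varepsilon)$ is the open ball, $N(x,U)=\{n\ge0:f^n(x)\in U\}$. Densities of a set $S$ of nonnegative integers: $\overline d(S)=\limsup_{n\to\infty}\frac{|S\cap\{0,\dots,n-1\}|}{n}$, $\underline d(S)=\liminf_{n\to\infty}\frac{|S\cap\{0,\dots,n-1\}|}{n}$, $\overline B(S)=\limsup_{|I|\to\infty}\frac{|S\cap I|}{|I|}$, $\underline B(S)=\liminf_{|I|\to\infty}\frac{|S\cap I|}{|I|}$, where $I$ ranges over finite intervals of consecutive integers. For $\xi\in\{\overline d,\underline d,\overline B,\underline B\}$, $\omega_\xi(x)=\{y\in X:\xi(N(x,B(y,\varepsilon)))>0\text{ for every }\varepsilon>0\}$. For a closed invariant $Y\subseteq X$, $M(f,Y)$ (resp. $M_{erg}(f,Y)$) denotes the set of $f$-invariant (resp. $f$-ergodic) Borel probability measures supported on $Y$. $S_\mu$ is the support of $\mu$. Measures carry the weak$^*$ topology. $V_f(x)$ is the set of limit points of the empirical measures $\mathcal E_n(x)=\frac1n\sum_{j=0}^{n-1}\delta_{f^j(x)}$, $n\to\infty$. $V_f^*(x)$ is the set of $\mu\in M(f,X)$ for which there are integer intervals $[a_k,b_k)$ with $b_k-a_k\to\infty$ and $\frac1{b_k-a_k}\sum_{j=a_k}^{b_k-1}\delta_{f^j(x)}\to\mu$. A nonempty closed invariant set is minimal if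 it contains no proper nonempty closed invariant subset. *)

(* Defs.v *)
From HB Require Import structures.
From mathcomp Require Import all_boot all_order all_algebra.
From mathcomp Require Import all_classical all_reals all_analysis.

Set Implicit Arguments.
Unset Strict Implicit.
Unset Printing Implicit Defensive.

Import Order.TTheory GRing.Theory Num.Theory.
Import numFieldNormedType.Exports.

Local Open Scope classical_set_scope.
Local Open Scope ring_scope.

(* Nonempty metric spaces: measurable types are pointed in the library, and
   the empty space carries neither points nor probability measures. *)
#[short(type="pmetricType")]
HB.structure Definition PointedMetric (K : numDomainType) :=
  {M of Pointed M & Metric K M}.

Notation borel X := (g_sigma_algebraType (@open X)).

Section Densities.
Variable R : realType.
Implicit Types (S : set nat).

(* |S `&` [a, b)| / (b - a), which is 0 when b <= a *)
Definition frequency S (a b : nat) : R :=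
  (\sum_(a <= i < b) (i \in S))%N%:R / (b - a)%N%:R.

Definition upper_density S : \bar R :=
  limn_esup (fun n => (frequency S 0 n)%:E).

Definition lower_density S : \bar R :=
  limn_einf (fun n => (frequency S 0 n)%:E).

(* The pair (a, b) stands for the interval [a, b) of natural numbers; this is
   the filter along which |I| tends to infinity, uniformly in the position
   of I. *)
Definition long_intervals : set_system (nat * nat) :=
  filter_from setT (fun n : nat => [set I | (n <= I.2 - I.1)%N]).

Definition upper_banach_density S : \bar R :=
  limf_esup (fun I : nat * nat => (frequency S I.1 I.2)%:E) long_intervals.

Definition lower_banach_density S : \bar R :=
  limf_einf (fun I : nat * nat => (frequency S I.1 I.2)%:E) long_intervals.

End Densities.

Section Orbits.
Variables (R : realType) (X : pmetricType R) (f : X -> X).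

Definition orb (x : X) : set X := range (fun n => iter n f x).

Definition omega_limit (x : X) : set X :=
  \bigcap_(n in [set n | (1 <= n)%N])
    closure (\bigcup_(k in [set k | (n <= k)%N]) [set iter k f x]).

Definition visits (x : X) (U : set X) : set nat := [set n | U (iter n f x)].

Definition omega_density (xi : set nat -> \bar R) (x : X) : set X :=
  [set y | forall e : R, 0 < e -> (0 < xi (visits x (ball y e)))%E].

Definition invariant_set (Y : set X) : Prop := f @` Y `<=` Y.

Definition minimal (Y : set X) : Prop :=
  [/\ Y !=set0, closed Y, invariant_set Y &
      forall Z : set X, Z !=set0 -> closed Z -> invariant_set Z ->
        Z `<=` Y -> Z = Y].

End Orbits.

Section WeakStar.
Variables (R : realType) (X : pmetricType R).

Definition integrals (mu : probability (borel X) R) :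
    prod_topology (fun _ : continuousType X R => R) :=
  fun phi => \int[mu]_x (phi x).

(* The weak* topology: the coarsest one making mu |-> \int phi dmu continuous
   for every continuous phi : X -> R. *)
Definition weak_star := initial_topology integrals.

HB.instance Definition _ := Topological.on weak_star.

End WeakStar.

Section Measures.
Variables (R : realType) (X : pmetricType R) (f : X -> X).
Implicit Types (mu : probability (borel X) R).

Definition msupport mu : set X :=
  [set y | forall U : set X, open_nbhs y U -> (0 < mu U)%E].

Definition invariant_measure mu : Prop :=
  forall A : set (borel X), measurable A -> mu (f @^-1` A) = mu A.

Definition ergodic_measure mu : Prop :=
  invariant_measure mu /\
  forall A : set (borel X), measurable A -> f @^-1` A = A ->
    (mu A = 0 \/ mu A = 1)%E.

Definition inv_measures (Y : set X) : set (probability (borel X) R) :=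
  [set mu | invariant_measure mu /\ mu Y = 1%E].

Definition erg_measures (Y : set X) : set (probability (borel X) R) :=
  [set mu | ergodic_measure mu /\ mu Y = 1%E].

(* (b - a)^-1 * \sum_(a <= j < b) \d_(f^j x); the last argument of mnormalize
   is a default value, used only when b <= a. *)
Definition empirical (x : X) (a b : nat) : probability (borel X) R :=
  mnormalize (msum (fun j => \d_(iter (a + j) f x : borel X)) (b - a))
             \d_(x : borel X).

Definition V_f (x : X) : set (probability (borel X) R) :=
  cluster ((fun n => empirical x 0 n : weak_star X) @ \oo).

Definition Vstar_f (x : X) : set (probability (borel X) R) :=
  [set mu | inv_measures setT mu /\
    exists a b : nat -> nat,
      (fun k => (b k - a k)%N) @ \oo --> \oo /\
      (fun k => empirical x (a k) (b k) : weak_star X) @ \oo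
        --> (mu : weak_star X)].

End Measures.

(* Main.v *)
Require Import Defs.
From HB Require Import structures.
From mathcomp Require Import all_boot all_order all_algebra.
From mathcomp Require Import all_classical all_reals all_analysis.
From mathcomp Require Import measurable_realfun.
From mathcomp Require Import ring lra zify.

Set Implicit Arguments.
Unset Strict Implicit.
Unset Printing Implicit Defensive.

Import Order.TTheory GRing.Theory Num.Theory.
Import numFieldNormedType.Exports.

Local Open Scope classical_set_scope.
Local Open Scope ring_scope.

(* The visit frequencies of a ball along intervals I of times are, up to a tent
   function, integrals against the empirical measures of I.  Since the
   probabilities on X form a weak* compact space (Tychonoff and Riesz), bounds on
   such frequencies along a filter of intervals amount to bounds on the integrals
   against all cluster points; this gives (1), (2) and the first equalities of
   (3), (4).  The families V*_f(x), M(f, omega_f(x)) and M_erg(f, omega_f(x)) have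
   the same intersection and the same closed union of supports because they
   dominate each other: for mu in one family and phi continuous there is nu in
   the other one with mu(phi) <= nu(phi).  To pass from M to V*, a point z of
   omega_f(x) has Birkhoff average at least mu(phi), and some orbit segment of x
   shadows that of z; to pass from M to M_erg, extreme points of the face where
   phi is maximal are ergodic.  For (5), the maximal ergodic inequality shows that
   almost every point of a measurable set returns to it with positive lower
   density, so x is in its own omega_ld(x), and all the sets coincide. *)

(** * Bounded measurable functions on a probability space *)

(** The sets [omega_density] record only positivity, and they test every radius; losing a factor 2
    and half the radius when a ball is replaced by a continuous function is therefore harmless. The
    delicate point is uniformity: strict positivity at each limit measure must yield one positive
    constant valid for all relevant intervals. Compactness of the set of cluster points supplies it,
    since an integral attains its extremum there. Cluster points of filters suit compactness,
    whereas [Vstar_f] asks for sequences of intervals; a countable family of functions that controls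
    all integrals of continuous functions bridges the two. An invariant measure on the omega-limit
    set need not be a limit of empirical measures of x, so the families in (3) and (4) are compared
    one integral at a time, and the dominating measure may depend on the function. Tents compare the
    unions of supports, their negatives the intersections. For (5) only a lower bound on visit
    frequencies is needed, not their convergence; this is why a maximal inequality can do the work
    of a pointwise ergodic theorem. *)

Section BoundedMeasurable.
Context d (T : measurableType d) (R : realType).
Implicit Types (mu : probability T R) (g h : T -> R).

(** The class of integrands used below: it contains the indicators of measurable sets and the
    continuous functions on a compact space, and on a probability space its members are integrable,
    so the real-valued integral is linear and monotone on it. *)
Definition bounded_measurable g : Prop :=
  measurable_fun setT g /\ exists M : R, forall x, `|g x| <= M.

Lemma bounded_measurable_integrable mu g :
  bounded_measurable g -> mu.-integrable setT (EFin \o g).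
Proof.
move=> [mg [M gM]]; apply: measurable_bounded_integrable => //.
  by rewrite /= probability_setT ltry.
by exists M; split => [|N MN x _ /=]; rewrite ?num_real// (le_trans (gM x))// ltW.
Qed.

Lemma bounded_measurable_cst (c : R) : bounded_measurable (cst c : T -> R).
Proof. by split => //; exists `|c|. Qed.

Lemma bounded_measurableD g h : bounded_measurable g -> bounded_measurable h ->
  bounded_measurable (fun x => g x + h x).
Proof.
move=> [mg [M gM]] [mh [N hN]]; split; first exact: measurable_funD.
by exists (M + N) => x; rewrite (le_trans (ler_normD _ _))// lerD.
Qed.

Lemma bounded_measurableZ (c : R) g : bounded_measurable g ->
  bounded_measurable (fun x => c * g x).
Proof.
move=> [mg [M gM]]; split; first exact: measurable_funM.
by exists (`|c| * M) => x; rewrite normrM ler_wpM2l.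
Qed.

Lemma bounded_measurableN g : bounded_measurable g ->
  bounded_measurable (fun x => - g x).
Proof.
move=> /(bounded_measurableZ (-1)); congr bounded_measurable.
by apply/funext => x; rewrite mulN1r.
Qed.

Lemma bounded_measurableB g h : bounded_measurable g -> bounded_measurable h ->
  bounded_measurable (fun x => g x - h x).
Proof.
by move=> bg bh; apply: bounded_measurableD => //; exact: bounded_measurableN.
Qed.

Lemma bounded_measurableM g h : bounded_measurable g -> bounded_measurable h ->
  bounded_measurable (fun x => g x * h x).
Proof.
move=> [mg [M gM]] [mh [N hN]]; split; first exact: measurable_funM.
by exists (M * N) => x; rewrite normrM ler_pM.
Qed.

Lemma bounded_measurable_max g h :
  bounded_measurable g -> bounded_measurable h ->
  bounded_measurable (fun x => Num.max (g x) (h x)).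
Proof.
move=> [mg [M gM]] [mh [N hN]]; split; first exact: measurable_maxr.
exists (M + N) => x; have := gM x; have := hN x.
have := normr_ge0 (g x); have := normr_ge0 (h x).
by rewrite /Num.max; case: ifPn => _; lra.
Qed.

Lemma bounded_measurable_sum (I : Type) (s : seq I) (F : I -> T -> R) :
  (forall i, bounded_measurable (F i)) ->
  bounded_measurable (fun x => \sum_(i <- s) F i x).
Proof.
move=> bF; elim: s => [|i s ih].
  by under eq_fun do rewrite big_nil; exact: bounded_measurable_cst.
by under eq_fun do rewrite big_cons; exact: bounded_measurableD.
Qed.

Lemma bounded_measurable_indic (A : set T) :
  measurable A -> bounded_measurable (\1_A : T -> R).
Proof.
move=> mA; split => //; exists 1 => x.
by rewrite indicE; case: (_ \in _); rewrite ?normr1 ?normr0.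
Qed.

Lemma bounded_measurable_comp g (f : T -> T) : measurable_fun setT f ->
  bounded_measurable g -> bounded_measurable (g \o f).
Proof.
by move=> mf [mg [M gM]]; split; [exact: measurableT_comp|exists M => x /=].
Qed.

Lemma Rintegral_cst_prob mu (c : R) : \int[mu]_x c = c.
Proof. by rewrite Rintegral_cst//= probability_setT mulr1. Qed.

Lemma bounded_RintegralD mu g h :
  bounded_measurable g -> bounded_measurable h ->
  \int[mu]_x (g x + h x) = \int[mu]_x g x + \int[mu]_x h x.
Proof.
by move=> bg bh; rewrite RintegralD//; exact: bounded_measurable_integrable.
Qed.

Lemma bounded_RintegralZ mu (c : R) g : bounded_measurable g ->
  \int[mu]_x (c * g x) = c * \int[mu]_x g x.
Proof.
by move=> bg; rewrite RintegralZl//; exact: bounded_measurable_integrable.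
Qed.

Lemma bounded_RintegralN mu g : bounded_measurable g ->
  \int[mu]_x (- g x) = - \int[mu]_x g x.
Proof.
move=> bg; rewrite -mulN1r -bounded_RintegralZ//.
by apply: eq_Rintegral => x _; rewrite mulN1r.
Qed.

Lemma bounded_RintegralB mu g h :
  bounded_measurable g -> bounded_measurable h ->
  \int[mu]_x (g x - h x) = \int[mu]_x g x - \int[mu]_x h x.
Proof.
by move=> bg bh; rewrite RintegralB//; exact: bounded_measurable_integrable.
Qed.

Lemma bounded_Rintegral_sum mu (I : Type) (s : seq I) (F : I -> T -> R) :
  (forall i, bounded_measurable (F i)) ->
  \int[mu]_x (\sum_(i <- s) F i x) = \sum_(i <- s) \int[mu]_x F i x.
Proof.
move=> bF; elim: s => [|i s ih].
  rewrite big_nil -[RHS](Rintegral_cst_prob mu 0).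
  by apply: eq_Rintegral => x _; rewrite big_nil.
rewrite big_cons -ih -bounded_RintegralD//; last exact: bounded_measurable_sum.
by apply: eq_Rintegral => x _; rewrite big_cons.
Qed.

Lemma bounded_le_Rintegral mu g h :
  bounded_measurable g -> bounded_measurable h -> (forall x, g x <= h x) ->
  \int[mu]_x g x <= \int[mu]_x h x.
Proof.
by move=> bg bh gh; apply: le_Rintegral => //; exact: bounded_measurable_integrable.
Qed.

Lemma Rintegral_indicE mu (A : set T) : measurable A ->
  (\int[mu]_x \1_A x)%:E = mu A.
Proof.
move=> mA; rewrite /Rintegral integral_indic// setIT fineK//.
exact: fin_num_measure.
Qed.

(** Adding (M + |c|) times the indicator of the complement of A to the constant c gives a bound for
    g that holds everywhere and still has integral c. *)
Lemma bounded_le_Rintegral_full mu g (A : set T) (c : R) :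
  bounded_measurable g -> measurable A -> mu A = 1%E ->
  (forall x, A x -> g x <= c) -> \int[mu]_x g x <= c.
Proof.
move=> bg mA muA gc; have [mg [M gM]] := bg.
have bI := bounded_measurable_indic (measurableC mA).
have I0 : \int[mu]_x \1_(~` A) x = 0.
  by apply: EFin_inj; rewrite Rintegral_indicE ?probability_setC ?muA ?subee//;
    exact: measurableC.
have bMI : bounded_measurable (fun x => (M + `|c|) * \1_(~` A) x).
  exact: bounded_measurableZ.
have -> : c = \int[mu]_x (c + (M + `|c|) * \1_(~` A) x).
  rewrite bounded_RintegralD//; last exact: bounded_measurable_cst.
  by rewrite bounded_RintegralZ// I0 mulr0 addr0 Rintegral_cst_prob.
apply: bounded_le_Rintegral => // [|x].
  by apply: bounded_measurableD => //; exact: bounded_measurable_cst.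
rewrite indicE; have [Ax|Ax] := pselect (A x).
  by rewrite memNset ?mulr0 ?addr0 ?gc//; exact: contrapT.
rewrite mem_set// mulr1; have := gM x; have := ler_norm (g x).
by have := ler_norm (- c); rewrite normrN; lra.
Qed.

(** If the integral vanished, g would be 0 almost everywhere, and A, on which g is positive, would
    be null. *)
Lemma Rintegral_gt0_measure mu g (A : set T) :
  bounded_measurable g -> measurable A -> (forall x, A x -> 0 < g x) ->
  (forall x, 0 <= g x) -> (0 < mu A)%E -> 0 < \int[mu]_x g x.
Proof.
move=> bg mA gA g0 muA; rewrite lt_neqAle Rintegral_ge0// andbT.
apply/eqP => /esym int0.
suff: mu A = 0 by move=> m0; rewrite m0 ltxx in muA.
have : ae_eq mu setT (EFin \o g) (cst 0%E).
  apply/integral_ae_eq => //.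
  - exact: bounded_measurable_integrable.
  - move=> E _ mE; rewrite integral_cst// mul0e.
    apply/eqP; rewrite eq_le; apply/andP; split; last first.
      by apply: integral_ge0 => x _; rewrite lee_fin.
    have <- : (\int[mu]_x (EFin \o g) x = 0)%E.
      have := int0; rewrite /Rintegral => i0.
      rewrite -[LHS]fineK ?[fine _]i0//.
      exact: integrable_fin_num (bounded_measurable_integrable _ bg).
    apply: ge0_subset_integral => //.
    - by apply/measurable_EFinP; case: bg.
    - by move=> x _; rewrite lee_fin.
move=> [N [mN muN]] sub; apply/eqP; rewrite eq_le measure_ge0 andbT -muN.
apply: le_measure; rewrite ?inE// => x Ax; apply: sub => /= /(_ I) [] gx.
by have := gA _ Ax; rewrite gx ltxx.
Qed.

Lemma Rintegral_gt0_pos mu g (A : set T) :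
  bounded_measurable g -> measurable A -> (forall x, g x <= \1_A x) ->
  0 < \int[mu]_x g x -> (0 < mu A)%E.
Proof.
move=> bg mA gA i0; rewrite -Rintegral_indicE// lte_fin (lt_le_trans i0)//.
by apply: bounded_le_Rintegral => //; exact: bounded_measurable_indic.
Qed.

End BoundedMeasurable.

(** * Continuous real functions and cluster points in compact spaces *)

Section ContinuousFunctions.
Context (R : realType) (T : topologicalType).
Implicit Types g h : T -> R.

Lemma continuous_funD g h : continuous g -> continuous h ->
  continuous (fun x => g x + h x).
Proof. by move=> cg ch x; apply: cvgD; [exact: cg|exact: ch]. Qed.

Lemma continuous_funN g : continuous g -> continuous (fun x => - g x).
Proof. by move=> cg x; apply: cvgN; exact: cg. Qed.

Lemma continuous_funB g h : continuous g -> continuous h ->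
  continuous (fun x => g x - h x).
Proof. by move=> cg ch x; apply: cvgB; [exact: cg|exact: ch]. Qed.

Lemma continuous_funM g h : continuous g -> continuous h ->
  continuous (fun x => g x * h x).
Proof. by move=> cg ch x; apply: cvgM; [exact: cg|exact: ch]. Qed.

Lemma continuous_funZ (c : R) g : continuous g -> continuous (fun x => c * g x).
Proof. by apply: continuous_funM => x; exact: cvg_cst. Qed.

Lemma continuous_funV g : continuous g -> (forall x, g x != 0) ->
  continuous (fun x => (g x)^-1).
Proof. by move=> cg g0 x; apply: cvgV => //; exact: cg. Qed.

Lemma continuous_fun_max g h : continuous g -> continuous h ->
  continuous (fun x => Num.max (g x) (h x)).
Proof.
by move=> cg ch x; apply: (@continuous_max R T g h x); [exact: cg|exact: ch].
Qed.

Lemma continuous_fun_min g h : continuous g -> continuous h ->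
  continuous (fun x => Num.min (g x) (h x)).
Proof.
by move=> cg ch x; apply: (@continuous_min R T g h x); [exact: cg|exact: ch].
Qed.

Lemma continuous_fun_sum (I : Type) (s : seq I) (F : I -> T -> R) :
  (forall i, continuous (F i)) -> continuous (fun x => \sum_(i <- s) F i x).
Proof.
move=> cF; elim: s => [|i s ih].
  by under eq_fun do rewrite big_nil; move=> x; exact: cvg_cst.
by under eq_fun do rewrite big_cons; exact: continuous_funD.
Qed.

Lemma open_lt_continuous g (c : R) : continuous g -> open [set x | g x < c].
Proof.
move=> cg; rewrite (_ : mkset _ = g @^-1` [set y | y < c])//.
by apply: open_comp => [x _|]; [exact: cg|exact: open_lt].
Qed.

Lemma open_gt_continuous g (c : R) : continuous g -> open [set x | c < g x].
Proof.
move=> cg; rewrite (_ : mkset _ = g @^-1` [set y | c < y])//.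
by apply: open_comp => [x _|]; [exact: cg|exact: open_gt].
Qed.

Lemma closed_ge_continuous g (c : R) : continuous g -> closed [set x | c <= g x].
Proof.
move=> cg; rewrite (_ : mkset _ = g @^-1` [set y | c <= y])//.
by apply: preimage_closed => //; exact: closed_ge.
Qed.

Lemma closed_eq_continuous g h : continuous g -> continuous h ->
  closed [set x | g x = h x].
Proof.
move=> cg ch.
rewrite (_ : mkset _ = (fun x => g x - h x) @^-1` [set 0]).
  apply: preimage_closed; last exact: closed_eq.
  by move=> x _; exact: continuous_funB.
by apply/seteqP; split => x /= => [->|/eqP]; rewrite ?subrr// subr_eq0 => /eqP.
Qed.

Lemma compact_min_continuous (K : set T) g : compact K -> K !=set0 ->
  continuous g -> exists2 x, K x & forall y, K y -> g x <= g y.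
Proof.
move=> cK K0 cg.
have [x xK gx] := compact_EVT_min K0 cK (continuous_subspaceT cg).
by exists x; [exact: set_mem|move=> y Ky; apply: gx; exact: mem_set].
Qed.

Lemma compact_max_continuous (K : set T) g : compact K -> K !=set0 ->
  continuous g -> exists2 x, K x & forall y, K y -> g y <= g x.
Proof.
move=> cK K0 cg.
have [x xK gx] := compact_EVT_max K0 cK (continuous_subspaceT cg).
by exists x; [exact: set_mem|move=> y Ky; apply: gx; exact: mem_set].
Qed.

Lemma compact_continuous_bounded g : compact [set: T] -> continuous g ->
  exists M : R, forall x, `|g x| <= M.
Proof.
move=> cT cg; have [[t _]|T0] := pselect ([set: T] !=set0).
  have [||x _ gx] := @compact_max_continuous _ (fun x => `|g x|) cT.
  - by exists t.
  - by move=> x; apply: cvg_norm; exact: cg.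
  by exists `|g x| => y; exact: gx.
by exists 0 => x; case: T0; exists x.
Qed.

(** If U is not in F, the trace of F on the complement of U is proper. Its cluster point is also one
    of F, hence lies in the open set U, which the trace avoids. *)
Lemma cluster_sub_open (F : set_system T) (U : set T) :
  compact [set: T] -> ProperFilter F -> open U -> cluster F `<=` U -> F U.
Proof.
move=> cT FF oU clU; apply: contrapT => nFU.
have PF : ProperFilter (within (~` U) F).
  constructor; last exact: within_filter.
  rewrite /within => FU; apply: nFU.
  apply: (@filterS _ F _ [set x | ~ U x -> False]) FU => x /= nUx.
  by apply: contrapT => /nUx.
have [p [_ clp]] := cT _ PF filterT.
have Up : U p.
  apply: clU => A B FA Bp; have WA : within (~` U) F A.
    by rewrite /within; apply: (@filterS _ F _ A) FA => x Ax _.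
  exact: (clp _ _ WA Bp).
have [x [/= nUx Ux]] : ~` U `&` U !=set0.
  by apply: clp; [exact: withinT|exact: open_nbhs_nbhs].
exact: nUx.
Qed.

Lemma compact_cluster (F : set_system T) : compact [set: T] -> compact (cluster F).
Proof.
move=> cT; apply: (subclosed_compact _ cT) => //; rewrite clusterE.
by apply: closed_bigI => A _; exact: closed_closure.
Qed.

(** The set of cluster points is compact and nonempty, so g has a maximum on it, which is below c;
    the midpoint between the two serves as c'. This turns pointwise strict inequalities into a
    uniform gap. *)
Lemma cluster_lt_near (F : set_system T) g (c : R) :
  compact [set: T] -> ProperFilter F -> continuous g ->
  (forall p, cluster F p -> g p < c) ->
  exists2 c', c' < c & \forall x \near F, g x <= c'.
Proof.
move=> cT FF cg clc.
have cl0 : cluster F !=set0 by have [p [_ ?]] := cT _ FF filterT; exists p.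
have [p clp gp] := compact_max_continuous (compact_cluster cT) cl0 cg.
exists ((g p + c) / 2); first by have := clc _ clp; lra.
suff: F [set x | g x < (g p + c) / 2] by apply: filterS => x /= /ltW.
apply: cluster_sub_open => //; first exact: open_lt_continuous.
by move=> q /gp /= ; have := clc _ clp; lra.
Qed.

Lemma cluster_le_near (F : set_system T) g (c : R) p :
  Filter F -> continuous g -> cluster F p ->
  (\forall x \near F, g x <= c) -> g p <= c.
Proof.
move=> FF cg clp Fc; apply/ler_addgt0Pr => e e0; rewrite leNgt; apply/negP => gp.
have [x [/= gx gx']] : [set x | g x <= c] `&` [set x | c < g x] !=set0.
  apply: clp => //; apply: open_nbhs_nbhs; split => /=; last by lra.
  exact: open_gt_continuous.
by move: gx'; rewrite ltNge gx.
Qed.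

End ContinuousFunctions.

Lemma compact_nat_cover (T : ptopologicalType) (K : set T) (U : nat -> set T) :
  compact K -> (forall n, open (U n)) -> K `<=` \bigcup_n U n ->
  exists N, K `<=` \bigcup_(n < N) U n.
Proof.
rewrite compact_cover => cK oU KU.
have [|D _ KD] := cK nat setT U (fun n _ => oU n); first exact: KU.
exists (\max_(i <- finmap.enum_fset D) i).+1 => x /KD[i /= iD Uix]; exists i => //=.
by rewrite ltnS; apply: (@leq_bigmax_seq _ _ xpredT id).
Qed.

(** * Functions on a compact metric space *)

Section MetricFunctions.
Context (R : realType) (X : pmetricType R).
Implicit Types (x y z : X) (A U : set X) (phi : X -> R).

Lemma mdist_sym x y : mdist x y = mdist y x.
Proof. exact: metric_sym. Qed.

Lemma mdist_triangle y x z : mdist x z <= mdist x y + mdist y z.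
Proof. exact: metric_triangle. Qed.

Lemma lipschitz_continuous phi (K : R) :
  (forall x y, phi x - phi y <= K * mdist x y) -> continuous phi.
Proof.
move=> phiK x; apply/cvgrPdist_le => /= e e0.
(* [K] may be zero or negative, so the modulus divides by |K| + 1. *)
have K0 : 0 < `|K| + 1 by have := normr_ge0 K; lra.
apply/metricType_numDomainType.nbhs_mdistP.
exists (e / (`|K| + 1)) => /=; first exact: divr_gt0.
move=> y /=; rewrite ltr_pdivlMr// => xye.
have := phiK x y; have := phiK y x; rewrite (mdist_sym y x) => yx xy.
have dxy := mdist_ge0 x y.
have : K * mdist x y <= `|K| * mdist x y by rewrite ler_wpM2r// ler_norm.
by rewrite ler_norml; lra.
Qed.

Lemma continuous_mdist y : continuous (mdist y : X -> R).
Proof.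
apply: (@lipschitz_continuous _ 1) => x z; rewrite mul1r.
by have := mdist_triangle z y x; rewrite (mdist_sym z x); lra.
Qed.

Lemma mem_ball y (e : R) z : ball y e z <-> mdist y z < e.
Proof. by rewrite ballEmdist. Qed.

Lemma open_mball y (e : R) : open (ball y e).
Proof.
by rewrite ballEmdist; apply: open_lt_continuous; exact: continuous_mdist.
Qed.

Lemma nbhs_mball y A : nbhs y A -> exists2 e : R, 0 < e & ball y e `<=` A.
Proof. by rewrite -nbhs_ballE => -[e /= e0 yA]; exists e. Qed.

Lemma mball_center y (e : R) : 0 < e -> ball y e y.
Proof. by move=> e0; apply/mem_ball; rewrite mdistxx. Qed.

Lemma open_nbhs_mball y (e : R) : 0 < e -> open_nbhs y (ball y e).
Proof. by move=> e0; split; [exact: open_mball|exact: mball_center]. Qed.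

(** The continuous substitute for the indicator of a ball: for e > 0 it is positive exactly on the
    ball of radius e, at most 1 there, and at least 1/2 on the ball of radius e / 2. *)
Definition tent y (e : R) z : R := Num.max 0 (1 - e^-1 * mdist y z).

Lemma continuous_tent y (e : R) : continuous (tent y e).
Proof.
apply: continuous_fun_max => [z|]; first exact: cvg_cst.
apply: continuous_funB => [z|]; first exact: cvg_cst.
by apply: continuous_funZ; exact: continuous_mdist.
Qed.

Lemma tent_ge0 y (e : R) z : 0 <= tent y e z.
Proof. by rewrite /tent le_max lexx. Qed.

Lemma tent_gt0 y (e : R) z : 0 < e -> 0 < tent y e z <-> ball y e z.
Proof.
move=> e0; rewrite mem_ball /tent lt_max ltxx/= subr_gt0 mulrC.
by rewrite ltr_pdivrMr// mul1r.
Qed.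

Lemma tent_le_indic y (e : R) z : 0 < e -> tent y e z <= \1_(ball y e) z.
Proof.
move=> e0; rewrite indicE; case: (boolP (z \in _)) => [_|].
  have : 0 <= e^-1 * mdist y z by rewrite mulr_ge0 ?mdist_ge0// invr_ge0 ltW.
  by rewrite /tent ge_max ler01/=; lra.
move=> /negP zU; rewrite leNgt; apply/negP => /(tent_gt0 _ _ e0) yz.
by apply: zU; exact: mem_set.
Qed.

Lemma indic_half_le_tent y (e : R) z : 0 < e ->
  2^-1 * \1_(ball y (e / 2)) z <= tent y e z.
Proof.
move=> e0; rewrite indicE; case: (boolP (z \in _)) => [|_]; last first.
  by rewrite mulr0 tent_ge0.
rewrite inE => /mem_ball yz; rewrite /tent le_max; apply/orP; right.
have : e^-1 * mdist y z < e^-1 * (e / 2) by rewrite ltr_pM2l ?invr_gt0.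
by rewrite mulrA mulVf ?gt_eqF// mul1r mulr1; lra.
Qed.

(** The function is the distance to A, which is 1-Lipschitz; the empty set gets the constant 1. *)
Lemma closed_zero_set A : closed A ->
  exists psi : X -> R,
    [/\ continuous psi, forall x, 0 <= psi x & forall x, psi x = 0 <-> A x].
Proof.
move=> cA; have [[a Aa]|A0] := pselect (A !=set0); last first.
  exists (cst 1); split => // [x|x]; first exact: cvg_cst.
  by split => [/eqP|Ax]; [rewrite oner_eq0|case: A0; exists x].
pose D x := [set mdist x y | y in A].
have D_inf x : has_inf (D x).
  split; first by exists (mdist x a), a.
  by exists 0 => _ [y _ <-]; exact: mdist_ge0.
have D_le x y : A y -> inf (D x) <= mdist x y.
  by move=> Ay; apply: inf_lbound; [exact: (D_inf x).2|exists y].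
have D_ge x (c : R) : (forall y, A y -> c <= mdist x y) -> c <= inf (D x).
  by move=> cx; apply: lb_le_inf; [exact: (D_inf x).1|move=> _ [y Ay <-]; exact: cx].
exists (fun x => inf (D x)); split.
- apply: (@lipschitz_continuous _ 1) => x y; rewrite mul1r lerBlDl -lerBlDr.
  apply: D_ge => z Az; rewrite lerBlDr (le_trans (D_le x z Az))// addrC.
  exact: mdist_triangle.
- by move=> x; apply: D_ge => y _; exact: mdist_ge0.
- move=> x; split => [Dx0|Ax]; last first.
    apply/eqP; rewrite eq_le (le_trans (D_le x x Ax)) ?mdistxx//.
    by apply: D_ge => y _; exact: mdist_ge0.
  apply: cA => B /nbhs_mball[e e0 xeB].
  have [_ [y Ay <-]] := inf_adherent e0 (D_inf x).
  by rewrite Dx0 add0r => xy; exists y; split => //; apply: xeB; exact/mem_ball.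
Qed.

Section Compact.
Hypothesis compactX : compact [set: X].

Lemma finite_net (e : R) : 0 < e ->
  exists s : seq X, forall x, exists2 z, z \in s & mdist z x < e.
Proof.
move=> e0; move: compactX; rewrite compact_cover => cX.
have [||D _ DX] := cX X setT (fun z => ball z e).
- by move=> z _; exact: open_mball.
- by move=> x _; exists x => //; exact: mball_center.
exists (finmap.enum_fset D) => x; have [z /= zD /mem_ball zx] := DX x I.
by exists z.
Qed.

Lemma uniform_continuity phi : continuous phi -> forall e : R, 0 < e ->
  exists2 d : R, 0 < d & forall x y, mdist x y < d -> `|phi x - phi y| < e.
Proof.
move=> cphi e e0.
(* Points around which the radius 1/(n+1) works. Finitely many of these open sets cover X, and a
   radius below all of theirs works everywhere. *)
pose U n := interior [set x | forall y, mdist x y < n.+1%:R^-1 -> `|phi x - phi y| < e].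
have [||N XN] := @compact_nat_cover X setT U compactX.
- by move=> n; exact: open_interior.
- move=> x _; have : nbhs x [set y | `|phi x - phi y| < e / 2].
    by move/cvgrPdist_lt: (cphi x); apply; rewrite divr_gt0.
  move=> /nbhs_mball[r r0 xr].
  have [n rn] : exists n : nat, n.+1%:R^-1 < r / 2.
    have r2 : 0 < r / 2 by rewrite divr_gt0.
    by have [n _ /(_ _ (leqnn n))/= ] := near_infty_natSinv_lt (PosNum r2); exists n.
  exists n => //; have : nbhs x (ball x n.+1%:R^-1).
    by apply: open_nbhs_nbhs; apply: open_nbhs_mball; rewrite invr_gt0.
  have dn : n.+1%:R^-1 + n.+1%:R^-1 < r by rewrite [ltRHS]splitr ltrD.
  apply: filterS => x' /mem_ball xx' y x'y.
  have : `|phi x - phi x'| < e / 2 by apply: xr; apply/mem_ball;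
    rewrite (lt_trans xx')// (lt_trans rn)// ltr_pdivrMr// ltr_pMr// ltr1n.
  have : `|phi x - phi y| < e / 2.
    apply: xr; apply/mem_ball; apply: (le_lt_trans (mdist_triangle x' x y)).
    by apply: lt_trans dn; exact: ltrD.
  by rewrite !ltr_norml; lra.
exists N.+1%:R^-1; first by rewrite invr_gt0.
move=> x y xy; have [n /= nN Unx] := XN x I.
have /= := interior_subset Unx; apply; rewrite (lt_le_trans xy)//.
by rewrite lef_pV2 ?posrE// ler_nat ltnS ltnW.
Qed.

Lemma countable_open_base : exists U : nat -> set X,
  (forall n, open (U n)) /\
  forall x A, nbhs x A -> exists2 n, U n x & U n `<=` A.
Proof.
have eps0 n : 0 < (n.+1%:R^-1 : R) by rewrite invr_gt0.
have /choice[s sP] : forall n, exists s : seq X,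
    forall x, exists2 z, z \in s & mdist z x < n.+1%:R^-1.
  by move=> n; exact: finite_net.
(* Balls of radius 1/(n+1) around the i-th point of a finite net of that mesh, indexed by the codes
   of the pairs (n, i); other codes give the empty set. *)
exists (fun j => if unpickle j is Some (n, i)
  then ball (nth point (s n) i) n.+1%:R^-1 else set0); split.
  move=> j; case: (unpickle j : option (nat * nat)) => [[n i]|].
    exact: open_mball.
  exact: open0.
move=> x A /nbhs_mball[r r0 xr].
have [n rn] : exists n : nat, n.+1%:R^-1 < r / 2.
  have r2 : 0 < r / 2 by rewrite divr_gt0.
  by have [n _ /(_ _ (leqnn n))/= ] := near_infty_natSinv_lt (PosNum r2); exists n.
have [z zs zx] := sP n x.
exists (pickle (n, index z (s n))); rewrite pickleK nth_index//; first exact/mem_ball.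
move=> y /mem_ball zy; apply: xr; apply/mem_ball.
apply: (le_lt_trans (mdist_triangle z x y)); rewrite (mdist_sym x z) [ltRHS]splitr.
by apply: ltrD; [exact: lt_trans rn|exact: lt_trans rn].
Qed.

End Compact.

End MetricFunctions.

(** * Borel probabilities and their supports *)

Section BorelProbabilities.
Context (R : realType) (X : pmetricType R).
Implicit Types (x y z : X) (A U : set X) (phi : X -> R).
Implicit Types (mu nu : probability (borel X) R).

Lemma open_borel_measurable U : open U -> measurable (U : set (borel X)).
Proof. by move=> oU; exact: sub_sigma_algebra. Qed.

Lemma closed_borel_measurable A : closed A -> measurable (A : set (borel X)).
Proof.
move=> cA; rewrite -[A]setCK; apply: measurableC.
by apply: open_borel_measurable; exact: closed_openC.
Qed.

Lemma continuous_borel_measurable phi :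
  continuous phi -> measurable_fun setT (phi : borel X -> R).
Proof.
move=> /continuousP cphi; apply: (measurability _ (RGenOpens.measurableE R)).
move=> _ [_ [a [b ->] <-]]; rewrite setTI; apply: open_borel_measurable.
by apply: cphi; exact: interval_open.
Qed.

Lemma continuous_borel_measurable_self (f : X -> X) :
  continuous f -> measurable_fun setT (f : borel X -> borel X).
Proof.
move=> /continuousP cf.
apply: (@measurability _ _ (borel X) (borel X) setT f (@open X)) => //.
by move=> _ [A oA <-]; rewrite setTI; apply: open_borel_measurable; exact: cf.
Qed.

Lemma closed_msupport mu : closed (msupport mu).
Proof.
move=> y cly U [oU Uy]; have [z [Sz Uz]] := cly _ (open_nbhs_nbhs (conj oU Uy)).
exact: Sz.
Qed.

Lemma msupport_sub mu A : closed A -> mu A = 1%E -> msupport mu `<=` A.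
Proof.
move=> cA muA y Sy; apply: contrapT => nAy.
have : (0 < mu (~` A))%E by apply: Sy; split => //; exact: closed_openC.
rewrite probability_setC; last exact: closed_borel_measurable.
by rewrite muA subee// ltxx.
Qed.

Hypothesis compactX : compact [set: X].

Lemma continuous_bounded_measurable phi :
  continuous phi -> bounded_measurable (phi : borel X -> R).
Proof.
move=> cphi; split; first exact: continuous_borel_measurable.
exact: compact_continuous_bounded.
Qed.

(** The sets {psi > 1/(n+1)} increase to U, and the continuous function min(1, (n+1) psi) lies
    between the indicator of such a set and that of U. *)
Lemma continuous_open_le mu nu U : open U ->
  (forall phi, continuous phi -> \int[mu]_x phi x = \int[nu]_x phi x) ->
  (mu U <= nu U)%E.
Proof.
move=> oU mn; have [psi [cpsi psi0 psiU]] := closed_zero_set (open_closedC oU).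
pose G n := [set x | n.+1%:R^-1 < psi x].
have oG n : open (G n) by exact: open_gt_continuous.
have GU : U = \bigcup_n G n.
  apply/seteqP; split => [x Ux|x [n _ /= Gx]].
    have px : 0 < psi x.
      by rewrite lt_neqAle psi0 andbT; apply/eqP => /esym/psiU; apply.
    by have [n _ /(_ _ (leqnn n))/= ] := near_infty_natSinv_lt (PosNum px); exists n.
  apply: contrapT => /psiU px; move: Gx; rewrite /G /= px ltNge invr_ge0.
  by rewrite ler0n.
have cvgG : (mu (G n) @[n --> \oo] --> mu U)%E.
  rewrite [in mu U]GU; apply: nondecreasing_cvg_mu.
  - by move=> n; exact: open_borel_measurable.
  - by rewrite -GU; exact: open_borel_measurable.
  - move=> m n mn'; apply/subsetPset => x /=; apply: le_lt_trans.
    by rewrite lef_pV2 ?posrE// ler_nat ltnS.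
rewrite -(cvg_lim (@ereal_hausdorff R) cvgG).
apply: lime_le; first by apply/cvg_ex; exists (mu U).
apply: nearW => n.
pose h x := Num.min 1 (n.+1%:R * psi x).
have ch : continuous h.
  apply: continuous_fun_min => [x|]; first exact: cvg_cst.
  exact: continuous_funZ.
have mG := open_borel_measurable (oG n); have mU := open_borel_measurable oU.
have bG := bounded_measurable_indic R mG.
have bU := bounded_measurable_indic R mU.
have bh := continuous_bounded_measurable ch.
rewrite -(Rintegral_indicE mu mG) -(Rintegral_indicE nu mU) lee_fin.
apply: (@le_trans _ _ (\int[mu]_x h x)).
  apply: bounded_le_Rintegral => // x; rewrite indicE /h.
  case: (boolP (x \in _)) => [|_].
    rewrite inE /G /= => Gx; rewrite le_min lexx /= -ler_pdivrMl// mulr1.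
    exact: ltW.
  by rewrite le_min ler01 /= mulr_ge0.
rewrite mn//; apply: bounded_le_Rintegral => // x; rewrite indicE /h.
case: (boolP (x \in _)) => [_|]; first by rewrite ge_min lexx.
by move=> /negP nU; rewrite (psiU x).2 ?mulr0 ?ge_min ?lexx ?orbT// => /mem_set.
Qed.

Lemma continuous_Rintegral_inj mu nu :
  (forall phi, continuous phi -> \int[mu]_x phi x = \int[nu]_x phi x) ->
  forall A : set (borel X), measurable A -> mu A = nu A.
Proof.
move=> mn A mA.
apply: (@measure_unique _ R (borel X) (@open X) (fun=> setT) _ _ _ _ mu nu) => //.
- by move=> U V; exact: openI.
- by move=> _; exact: openT.
- by rewrite bigcup_const//; exists 0.
- move=> U oU; apply/eqP; rewrite eq_le !continuous_open_le//.
  by move=> phi /mn.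
- by move=> _; rewrite /= probability_setT ltry.
Qed.

(** A point off the support has a null neighbourhood, hence a null neighbourhood from the countable
    base; the null members of the base thus cover the complement. *)
Lemma msupport_full mu : mu (msupport mu) = 1%E.
Proof.
have [U [oU baseU]] := countable_open_base compactX.
have mS := closed_borel_measurable (@closed_msupport mu).
suff S0 : mu (~` msupport mu) = 0%E.
  by rewrite -[msupport mu]setCK probability_setC ?S0 ?sube0//; exact: measurableC.
apply/negligibleP; first exact: measurableC.
have : mu.-negligible (\bigcup_n (if mu (U n) == 0%E then U n else set0)).
  apply: negligible_bigcup => n; case: ifPn => [/eqP U0|_].
    by apply/negligibleP => //; exact: open_borel_measurable.
  exact: negligible_set0.
apply: negligibleS => y /existsNP[V /not_implyP[[oV Vy] nV]].
have [n Uny UV] := baseU y V (open_nbhs_nbhs (conj oV Vy)).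
exists n => //; rewrite ifT//; apply/eqP/le_anti/andP; split => //.
rewrite (@le_trans _ _ (mu V))//; last by rewrite leNgt; apply/negP.
by apply: le_measure => //; rewrite inE; exact: open_borel_measurable.
Qed.

Lemma msupport_meets mu (A : set (borel X)) : measurable A -> (0 < mu A)%E ->
  A `&` msupport mu !=set0.
Proof.
move=> mA A0; apply/set0P/eqP => AS0.
have mS := closed_borel_measurable (@closed_msupport mu).
have : (mu A <= mu (~` msupport mu))%E.
  apply: le_measure; rewrite ?inE//; first exact: measurableC.
  exact/disjoints_subset.
by rewrite probability_setC// msupport_full subee// leNgt A0.
Qed.

Lemma msupport_nonempty mu : msupport mu !=set0.
Proof.
have [||x [_ Sx]] := @msupport_meets mu setT => //; last by exists x.
by rewrite probability_setT.
Qed.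

Lemma bounded_measurable_tent y (e : R) :
  bounded_measurable (tent y e : borel X -> R).
Proof. by apply: continuous_bounded_measurable; exact: continuous_tent. Qed.

Lemma tent_measure_gt0 mu y (e : R) : 0 < e ->
  0 < \int[mu]_x tent y e x <-> (0 < mu (ball y e))%E.
Proof.
move=> e0; have mB := open_borel_measurable (open_mball (y : X) e).
have bB := bounded_measurable_tent y e.
split => [|B0]; first apply: Rintegral_gt0_pos => //.
  by move=> x; exact: tent_le_indic.
apply: (Rintegral_gt0_measure bB mB) => // x; first by move/tent_gt0; apply.
exact: tent_ge0.
Qed.

(** Membership in a support is expressed by integrals of continuous functions, which can be compared
    with orbit averages and between measures; [closure_msupport_tent] does the same for closed
    unions of supports. *)
Lemma msupport_tent mu y :
  msupport mu y <-> forall e : R, 0 < e -> 0 < \int[mu]_x tent y e x.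
Proof.
split => [Sy e e0|By U [oU Uy]].
  by apply/tent_measure_gt0 => //; apply: Sy; exact: open_nbhs_mball.
have [e e0 yU] := nbhs_mball (open_nbhs_nbhs (conj oU Uy)).
apply: (@lt_le_trans _ _ (mu (ball y e))); first exact/tent_measure_gt0/By.
by apply: le_measure => //; rewrite inE; apply: open_borel_measurable => //;
  exact: open_mball.
Qed.

Lemma closure_msupport_tent (B : set (probability (borel X) R)) y :
  closure (\bigcup_(mu in B) msupport mu) y <->
  forall e : R, 0 < e -> exists2 mu, B mu & 0 < \int[mu]_x tent y e x.
Proof.
split => [cly e e0|By V /nbhs_mball[e e0 yV]].
  have [z [[mu Bmu Sz] yz]] := cly _ (open_nbhs_nbhs (open_nbhs_mball y e0)).
  exists mu => //; apply/tent_measure_gt0 => //; apply: Sz; split => //.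
  exact: open_mball.
have [mu Bmu /tent_measure_gt0 yB] := By e e0.
have [||z [yz Sz]] := @msupport_meets mu (ball y e).
- by apply: open_borel_measurable; exact: open_mball.
- exact: yB.
by exists z; split; [exists mu|exact: yV].
Qed.

End BorelProbabilities.

(** * The Riesz representation theorem on a compact metric space *)

Section RieszRepresentation.
Context (R : realType) (X : pmetricType R).
Hypothesis compactX : compact [set: X].
Implicit Types (A U V W : set X) (phi psi : X -> R).

Variable L : (X -> R) -> R.
Hypothesis LD : forall phi psi, continuous phi -> continuous psi ->
  L (fun x => phi x + psi x) = L phi + L psi.
Hypothesis LZ : forall (c : R) phi, continuous phi ->
  L (fun x => c * phi x) = c * L phi.
Hypothesis L_mono : forall phi psi, continuous phi -> continuous psi ->
  (forall x, phi x <= psi x) -> L phi <= L psi.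
Hypothesis L1 : L (fun=> 1) = 1.

Let continuous_cst (c : R) : continuous (fun _ : X => c).
Proof. by move=> x; exact: cvg_cst. Qed.

Let Lcst (c : R) : L (fun=> c) = c.
Proof.
by rewrite -[RHS]mulr1 -L1 -LZ//; congr L; apply/funext => x; rewrite mulr1.
Qed.

(** * The content of an open set defined by a positive functional *)

Let subordinate U phi : Prop :=
  [/\ continuous phi, forall x, 0 <= phi x <= 1 & forall x, 0 < phi x -> U x].

Let content U : R := sup [set L phi | phi in subordinate U].

Let subordinate0 U : subordinate U (fun=> 0).
Proof. by split => // x; rewrite ?lexx ?ler01// ltxx. Qed.

Let has_sup_content U : has_sup [set L phi | phi in subordinate U].
Proof.
split; first by exists (L (fun=> 0)), (fun=> 0).
exists 1 => _ [phi [cphi phi01 _] <-]; rewrite -L1; apply: L_mono => // x.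
by case/andP: (phi01 x).
Qed.

Let le_content U phi : subordinate U phi -> L phi <= content U.
Proof.
by move=> Uphi; apply: sup_ubound; [exact: (has_sup_content U).2|exists phi].
Qed.

Let content_le U (c : R) :
  (forall phi, subordinate U phi -> L phi <= c) -> content U <= c.
Proof.
move=> Uc; apply: ge_sup; first exact: (has_sup_content U).1.
by move=> _ [phi Uphi <-]; exact: Uc.
Qed.

Let content_ge0 U : 0 <= content U.
Proof. by rewrite -(Lcst 0); exact: le_content. Qed.

Let content_mono U V : U `<=` V -> content U <= content V.
Proof.
move=> UV; apply: content_le => phi [? ? phiU]; apply: le_content; split => //.
by move=> x /phiU /UV.
Qed.

Let content0 : content set0 = 0.
Proof.
apply/eqP; rewrite eq_le content_ge0 andbT; apply: content_le.
move=> phi [cphi phi01 phi0]; rewrite -(Lcst 0); apply: L_mono => // x.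
by rewrite leNgt; apply/negP => /phi0.
Qed.

Let contentT : content setT = 1.
Proof.
apply/eqP; rewrite eq_le; apply/andP; split.
  apply: content_le => phi [cphi phi01 _]; rewrite -L1; apply: L_mono => // x.
  by case/andP: (phi01 x).
by rewrite -L1; apply: le_content; split => // x; rewrite ler01 lexx.
Qed.

(** Subordination asks for no compact support; truncation restores it. The truncated function is
    positive only inside {phi >= e}, a compact subset of the open set when phi is continuous and e >
    0, and [L] drops by at most e. *)
Let trunc (e : R) phi x : R := Num.max 0 (phi x - e).

Let trunc_subordinate U V (e : R) phi : 0 < e -> subordinate U phi ->
  (forall x, e <= phi x -> V x) -> subordinate V (trunc e phi).
Proof.
move=> e0 [cphi phi01 phiU] phiV; split.
- by apply: continuous_fun_max => //; exact: continuous_funB.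
- move=> x; rewrite le_max lexx /= ge_max ler01 /=.
  by case/andP: (phi01 x) => _; lra.
- by move=> x; rewrite lt_max ltxx /= subr_gt0 => /ltW /phiV.
Qed.

Let le_L_trunc (e : R) phi : continuous phi -> L phi <= L (trunc e phi) + e.
Proof.
move=> cphi; rewrite -[X in _ + X](Lcst e) -LD//; last first.
  by apply: continuous_fun_max => //; exact: continuous_funB.
apply: L_mono => //; last first.
  by move=> x; rewrite -lerBlDr le_max lexx orbT.
apply: continuous_funD => //; apply: continuous_fun_max => //.
exact: continuous_funB.
Qed.

(** Up to e, phi is cut in two. Let a be the distance to the complement of U, and k so large that
    phi <= k a on the compact set {phi >= e} minus V. Then min(phi, k a) is subordinate to U, and
    the positive part of phi - k a - e to V. *)
Let content_setU U V : open U -> open V ->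
  content (U `|` V) <= content U + content V.
Proof.
move=> oU oV; apply: content_le => phi Uphi; apply/ler_addgt0Pr => e e0.
have [cphi phi01 phiU] := Uphi.
have [a [ca a0 aU]] := closed_zero_set (open_closedC oU).
pose K := [set x | e <= phi x] `&` ~` V.
have cK : compact K.
  apply: (subclosed_compact _ compactX) => //; apply: closedI.
    exact: closed_ge_continuous.
  exact: open_closedC.
have Ka x : K x -> 0 < a x.
  move=> [/= ex nVx]; rewrite lt_neqAle a0 andbT; apply/eqP => /esym/aU nUx.
  by have [|//|//] := phiU x; rewrite (lt_le_trans e0).
(* As phi <= 1, the inverse of the minimum of a on K suffices; any k does when K is empty. *)
have [k k0 Kk] : exists2 k : R, 0 < k & forall x, K x -> phi x <= k * a x.
  have [K0|K0] := pselect (K !=set0); last first.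
    by exists 1 => // x Kx; case: K0; exists x.
  have [m Km am] := compact_min_continuous cK K0 ca.
  exists (a m)^-1; first by rewrite invr_gt0 Ka.
  move=> x Kx; apply: (@le_trans _ _ 1); first by case/andP: (phi01 x).
  by rewrite mulrC ler_pdivlMr ?mul1r ?am// Ka.
pose phi1 x := Num.min (phi x) (k * a x).
pose phi2 x := Num.max 0 (phi x - k * a x - e).
have cka : continuous (fun x => k * a x) by exact: continuous_funZ.
have c1 : continuous phi1 by exact: continuous_fun_min.
have c2 : continuous phi2.
  apply: continuous_fun_max => //; apply: continuous_funB => //.
  exact: continuous_funB.
have ka0 x : 0 <= k * a x by rewrite mulr_ge0// ltW.
have s1 : subordinate U phi1.
  split => // x; have /andP[p0 p1] := phi01 x.
    by rewrite le_min p0 ka0 /= ge_min p1.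
  rewrite lt_min => /andP[_]; rewrite pmulr_rgt0// => ax; apply: contrapT.
  by move=> /aU ax0; rewrite ax0 ltxx in ax.
have s2 : subordinate V phi2.
  split => // x; have /andP[p0 p1] := phi01 x; have kax := ka0 x.
    by rewrite le_max lexx /= ge_max ler01 /=; lra.
  rewrite lt_max ltxx /= => p2; apply: contrapT => nVx.
  have ex : e <= phi x by lra.
  by have := Kk x (conj ex nVx); lra.
have -> : content U + content V + e = content U + (content V + e) by rewrite addrA.
apply: (@le_trans _ _ (L phi1 + (L phi2 + e))); last first.
  by rewrite lerD ?le_content// lerD2r le_content.
rewrite -[X in _ + (_ + X)](Lcst e) -!LD//; last exact: continuous_funD.
apply: L_mono => //; first by do 2 apply: continuous_funD => //.
by move=> x; rewrite /phi1 /phi2 /Num.min /Num.max; case: ifP; case: ifP; lra.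
Qed.

(** A near-optimal phi for the union, once truncated, lives on a compact set that finitely many of
    the U n cover; finite subadditivity then applies. *)
Let content_bigcup (U : nat -> set X) : (forall n, open (U n)) ->
  ((content (\bigcup_n U n))%:E <= \sum_(n <oo) (content (U n))%:E)%E.
Proof.
move=> oU; have fin N : content (\bigcup_(n < N) U n) <= \sum_(n < N) content (U n).
  rewrite bigcup_mkord; elim: N => [|N ih]; first by rewrite !big_ord0 content0.
  rewrite !big_ord_recr /=; apply: (le_trans (content_setU _ _)) => //.
    by rewrite -bigcup_mkord; apply: bigcup_open => n _.
  by rewrite lerD2r.
apply/lee_addgt0Pr => e e0.
rewrite -leeBlDr// -EFinB.
have [N eN] : exists N, content (\bigcup_n U n) - e <= content (\bigcup_(n < N) U n).
  have e2 : 0 < e / 2 by rewrite divr_gt0.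
  have [_ [phi Uphi <-]] := sup_adherent e2 (has_sup_content (\bigcup_n U n)).
  rewrite -/(content _) => phie; have [cphi phi01 phiU] := Uphi.
  have cK : compact [set x | e / 2 <= phi x].
    by apply: (subclosed_compact _ compactX) => //; exact: closed_ge_continuous.
  have [|N KN] := compact_nat_cover cK oU.
    by move=> x /= ex; apply: phiU; exact: lt_le_trans ex.
  exists N; have := le_content (trunc_subordinate e2 Uphi KN).
  by have := le_L_trunc (e / 2) cphi; lra.
apply: (@le_trans _ _ (\sum_(0 <= n < N) content (U n))%:E).
  by rewrite lee_fin big_mkord (le_trans eN).
rewrite -sumEFin; apply: nneseries_lim_ge => n _.
by rewrite lee_fin content_ge0.
Qed.

(* The measure is the Caratheodory extension of [content]; Borel sets being
   approximated from outside by open sets, it agrees with [content] on these. *)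
Let outer A : R := inf [set content U | U in [set U | open U /\ A `<=` U]].

Let has_inf_outer A : has_inf [set content U | U in [set U | open U /\ A `<=` U]].
Proof.
split; first by exists (content setT), setT => //; split => //; exact: openT.
by exists 0 => _ [U _ <-]; exact: content_ge0.
Qed.

Let outer_le A U : open U -> A `<=` U -> outer A <= content U.
Proof.
by move=> oU AU; apply: inf_lbound; [exact: (has_inf_outer A).2|exists U].
Qed.

Let le_outer A (c : R) :
  (forall U, open U -> A `<=` U -> c <= content U) -> c <= outer A.
Proof.
move=> Ac; apply: lb_le_inf; first exact: (has_inf_outer A).1.
by move=> _ [U [oU AU] <-]; exact: Ac.
Qed.

Let outer_open U : open U -> outer U = content U.
Proof.
move=> oU; apply/eqP; rewrite eq_le outer_le//=.
by apply: le_outer => V oV UV; exact: content_mono.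
Qed.

Let outer_ge0 A : 0 <= outer A.
Proof. by apply: le_outer => U _ _; exact: content_ge0. Qed.

Let outer_sigma_subadditive :
  sigma_subadditive (fun A => (outer A)%:E : \bar R).
Proof.
move=> F; apply/lee_addgt0Pr => e e0.
have eps0 n : 0 < e / (2 ^ n.+1)%:R by rewrite divr_gt0// ltr0n expn_gt0.
have /choice[U UP] : forall n, exists U, [/\ open U, F n `<=` U &
    content U <= outer (F n) + e / (2 ^ n.+1)%:R].
  move=> n; have [_ [U [oU FU] <-]] := inf_adherent (eps0 n) (has_inf_outer (F n)).
  by rewrite -/(outer _) => /ltW; exists U.
apply: (@le_trans _ _ (content (\bigcup_n U n))%:E).
  rewrite lee_fin; apply: outer_le; first by apply: bigcup_open => n _; case: (UP n).
  by apply: subset_bigcup => n _; case: (UP n).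
apply: (le_trans (content_bigcup _)); first by move=> n; case: (UP n).
apply: le_trans (epsilon_trick _ _ _); last exact: ltW.
  apply: lee_nneseries => n _; first by move=> _; rewrite lee_fin content_ge0.
  by rewrite -EFinD lee_fin; case: (UP n).
by move=> n; rewrite lee_fin outer_ge0.
Qed.

Let outer_set0 : (outer set0)%:E = 0%E.
Proof. by rewrite outer_open ?content0//; exact: open0. Qed.

Let outer_ge0E A : (0 <= (outer A)%:E)%E.
Proof. by rewrite lee_fin outer_ge0. Qed.

Let outer_mono :
  {homo (fun A => (outer A)%:E : \bar R) : A B / A `<=` B >-> (A <= B)%E}.
Proof.
move=> A B AB; rewrite lee_fin; apply: le_outer => U oU BU.
by apply: outer_le => //; exact: subset_trans BU.
Qed.

Let outer_mu : {outer_measure set X -> \bar R} :=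
  HB.pack (fun A => (outer A)%:E : \bar R)
    (isOuterMeasure.Build R X (fun A => (outer A)%:E)
      outer_set0 outer_ge0E outer_mono outer_sigma_subadditive).

(** For T inside an open W, take phi nearly optimal for W [&] U, put K = {phi >= e/3}, and take psi
    nearly optimal for W minus K. The truncation of phi vanishes off K and psi vanishes on K, so
    their sum is at most 1 and is subordinate to W; moreover T minus U lies in W minus K. *)
Let caratheodory_open U : open U -> outer_mu.-caratheodory U.
Proof.
move=> oU; apply: le_caratheodory_measurable => T.
rewrite [outer_mu _]/= [outer_mu _]/= [outer_mu _]/= -EFinD lee_fin.
apply: le_outer => W oW TW; apply/ler_addgt0Pr => e e0.
(* One third each for the choice of phi, the choice of psi and the truncation. *)
have e3 : 0 < e / 3 by rewrite divr_gt0.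
have [_ [phi Uphi <-]] := sup_adherent e3 (has_sup_content (W `&` U)).
rewrite -/(content _) => phie; have [cphi phi01 phiU] := Uphi.
pose K := [set x | e / 3 <= phi x].
have oWK : open (W `&` ~` K).
  by apply: openI => //; apply: closed_openC; exact: closed_ge_continuous.
have [_ [psi Kpsi <-]] := sup_adherent e3 (has_sup_content (W `&` ~` K)).
rewrite -/(content _) => psie; have [cpsi psi01 psiK] := Kpsi.
have [ct t01 tU] : subordinate (W `&` U) (trunc (e / 3) phi).
  apply: (trunc_subordinate e3 Uphi) => x ex; apply: phiU.
  exact: lt_le_trans ex.
have sW : subordinate W (fun x => trunc (e / 3) phi x + psi x).
  split.
  - exact: continuous_funD.
  - move=> x; have := t01 x; have := psi01 x; have := psiK x.
    have [ex|ex] := leP (e / 3) (phi x).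
      have [_ /(_ isT)[_ /(_ ex)]//|] := ltP 0 (psi x).
      by move=> ? _ /andP[? ?] /andP[? ?]; apply/andP; split; lra.
    have -> : trunc (e / 3) phi x = 0 by apply/max_idPl; lra.
    by rewrite add0r.
  - move=> x; have [/tU[]//|tx] := ltP 0 (trunc (e / 3) phi x).
    have [/psiK[]//|px] := ltP 0 (psi x).
    by rewrite ltNge -(addr0 0) lerD.
have := le_content sW; rewrite LD//.
have := le_L_trunc (e / 3) cphi.
have : outer (T `&` U) <= content (W `&` U).
  by apply: outer_le; [exact: openI|exact: setSI].
have : outer (T `&` ~` U) <= content (W `&` ~` K).
  apply: outer_le => // x [Tx nUx]; split; first exact: TW.
  move=> Kx; apply: nUx; have [] // := phiU x.
  by rewrite (lt_le_trans _ Kx).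
by move: phie psie; lra.
Qed.

Let borel_caratheodory (A : set (borel X)) :
  measurable A -> outer_mu.-caratheodory A.
Proof.
apply: smallest_sub => /=; last by move=> U; exact: caratheodory_open.
split.
- exact: (caratheodory_measurable_set0 outer_mu).
- by move=> B cB; rewrite setTD; exact: (@caratheodory_measurable_setC _ _ outer_mu).
- exact: (@caratheodory_measurable_bigcup _ _ outer_mu).
Qed.

Let riesz_mu (A : set (borel X)) : \bar R := outer_mu A.

Let riesz_mu_additive : semi_sigma_additive riesz_mu.
Proof.
move=> F mF tF mUF.
apply: (@caratheodory_measure_sigma_additive _ _ outer_mu F) => //.
- by move=> n; exact: borel_caratheodory.
- exact: borel_caratheodory.
Qed.

HB.instance Definition _ := isMeasure.Build _ (borel X) R riesz_mu
  (outer_measure0 outer_mu) (outer_measure_ge0 outer_mu) riesz_mu_additive.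

Let riesz_mu_setT : riesz_mu setT = 1%E.
Proof. by rewrite /riesz_mu /= outer_open ?contentT//; exact: openT. Qed.

HB.instance Definition _ :=
  Measure_isProbability.Build _ (borel X) R riesz_mu riesz_mu_setT.

Let riesz_prob : probability (borel X) R := riesz_mu.

Let riesz_prob_open U : open U -> riesz_prob U = (content U)%:E.
Proof. by move=> oU; rewrite /riesz_prob /= /riesz_mu /= outer_open. Qed.

(** * Comparison of the functional with the integral by horizontal slices *)

Let slice (h t : R) (i : nat) : R := Num.min (Num.max 0 (t - i%:R * h)) h.

Let sum_slice (h t : R) N : 0 <= h -> 0 <= t ->
  \sum_(i < N) slice h t i = Num.min t (N%:R * h).
Proof.
move=> h0 t0; elim: N => [|N ih].
  by rewrite big_ord0 mul0r; apply/esym/min_idPr.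
rewrite big_ord_recr /= ih /slice -natr1 mulrDl mul1r.
move: (N%:R * h) (mulr_ge0 (ler0n R N) h0) => q q0.
by rewrite /Num.min /Num.max; do ! case: ifP; lra.
Qed.

Let sum_level (h t : R) N : 0 <= h -> 0 <= t ->
  \sum_(i < N) h * (i%:R * h < t)%R%:R <= Num.min (N%:R * h) (t + h).
Proof.
move=> h0 t0; elim: N => [|N ih].
  by rewrite big_ord0 mul0r le_min lexx addr_ge0.
rewrite big_ord_recr /= -natr1 mulrDl mul1r; move: ih.
move: (\sum_(i < N) _) (N%:R * h) (mulr_ge0 (ler0n R N) h0) => S q q0.
by case: ltP => qt; rewrite ?mulr1 ?mulr0 !le_min => /andP[? ?]; apply/andP; split; lra.
Qed.

Let L_sum (F : nat -> X -> R) N : (forall i, continuous (F i)) ->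
  L (fun x => \sum_(i < N) F i x) = \sum_(i < N) L (F i).
Proof.
move=> cF; elim: N => [|N ih].
  by rewrite big_ord0 -[RHS](Lcst 0); congr L; apply/funext => x; rewrite big_ord0.
rewrite big_ord_recr /= -ih -LD//.
  by congr L; apply/funext => x; rewrite big_ord_recr.
by apply: continuous_fun_sum => i; exact: cF.
Qed.

(** A layer-cake estimate: the slice of phi between the levels i h and (i+1) h, divided by h, is
    subordinate to G i = {phi > i h}, so [L] of the slice is at most h times the measure of G i; and
    the sum of the h 1_(G i) exceeds phi by at most h. *)
Let L_le_Rintegral01 phi : continuous phi -> (forall x, 0 <= phi x <= 1) ->
  L phi <= \int[riesz_prob]_x phi x.
Proof.
move=> cphi phi01.
have bphi := continuous_bounded_measurable compactX cphi.
suff main n : L phi <= \int[riesz_prob]_x phi x + n.+1%:R^-1.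
  apply/ler_addgt0Pr => e e0.
  have [n _ /(_ _ (leqnn n))/= ne] := near_infty_natSinv_lt (PosNum e0).
  by rewrite (le_trans (main n))// lerD2l ltW.
pose h : R := n.+1%:R^-1.
have h0 : 0 < h by rewrite invr_gt0.
have nh : n.+1%:R * h = 1 by rewrite mulfV.
pose G (i : nat) := [set x | i%:R * h < phi x].
have oG i : open (G i) by exact: open_gt_continuous.
have cs i : continuous (fun x => slice h (phi x) i).
  apply: continuous_fun_min => //; apply: continuous_fun_max => //.
  exact: continuous_funB.
have sG i : subordinate (G i) (fun x => n.+1%:R * slice h (phi x) i).
  split; first exact: continuous_funZ.
    move=> x; have hi : 0 <= slice h (phi x) i <= h.
      by rewrite /slice le_min le_max lexx (ltW h0) /= ge_min lexx orbT.
    case/andP: hi => s0 sh; rewrite mulr_ge0//= -[leRHS]nh ler_wpM2l//.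
  move=> x; rewrite pmulr_rgt0// /slice lt_min h0 andbT lt_max ltxx /=.
  by rewrite subr_gt0.
have mG i := open_borel_measurable (oG i).
have -> : phi = (fun x => \sum_(i < n.+1) slice h (phi x) i).
  apply/funext => x; have /andP[p0 p1] := phi01 x.
  by rewrite sum_slice// ?nh; [apply/esym/min_idPl|exact: ltW].
rewrite (L_sum n.+1 cs).
apply: (@le_trans _ _ (\sum_(i < n.+1) h * \int[riesz_prob]_x \1_(G i) x)).
  apply: ler_sum => i _; rewrite -ler_pdivrMl// /h invrK -LZ//.
  have := le_content (sG i); rewrite -lee_fin -(riesz_prob_open (oG i)).
  by rewrite -(Rintegral_indicE _ (mG i)) lee_fin.
have bI i : bounded_measurable (fun x : borel X => h * \1_(G i) x : R).
  by apply: bounded_measurableZ; exact: bounded_measurable_indic.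
rewrite (eq_bigr (fun i : 'I_n.+1 =>
    \int[riesz_prob]_x (h * \1_(G i) x))); last first.
  by move=> i _; rewrite bounded_RintegralZ//; exact: bounded_measurable_indic.
rewrite -(bounded_Rintegral_sum _ _ (fun i : 'I_n.+1 => bI i)).
have bs : bounded_measurable (fun x : borel X => \sum_(i < n.+1) slice h (phi x) i : R).
  by apply: bounded_measurable_sum => i; exact: continuous_bounded_measurable.
rewrite -/h -[X in _ + X](Rintegral_cst_prob riesz_prob h).
rewrite -bounded_RintegralD//; last exact: bounded_measurable_cst.
apply: bounded_le_Rintegral.
- by apply: bounded_measurable_sum => i; exact: bI.
- by apply: bounded_measurableD => //; exact: bounded_measurable_cst.
- move=> x; have /andP[p0 p1] := phi01 x; rewrite (sum_slice _ (ltW h0) p0) nh.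
  rewrite (min_idPl p1); have := sum_level n.+1 (ltW h0) p0.
  rewrite le_min => /andP[_]; congr (_ <= _).
  apply: eq_bigr => i _; rewrite indicE.
  by have -> : (x \in G i) = (i%:R * h < phi x) by apply/idP/idP; rewrite inE.
Qed.

Let L_le_Rintegral phi : continuous phi -> L phi <= \int[riesz_prob]_x phi x.
Proof.
move=> cphi; have [M phiM] := compact_continuous_bounded compactX cphi.
have M0 : 0 <= M by rewrite (le_trans _ (phiM point)).
(* phi + M takes values in [0, 2M]; the extra 1 keeps the divisor positive when M = 0. *)
pose c := (2 * M + 1)^-1.
have c0 : 0 < c by rewrite invr_gt0; lra.
have cc : c * (2 * M + 1) = 1 by rewrite mulVf// gt_eqF//; lra.
have cM : continuous (fun x => phi x + M) by exact: continuous_funD.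
have bphi := continuous_bounded_measurable compactX cphi.
have bM := continuous_bounded_measurable compactX cM.
have := @L_le_Rintegral01 (fun x => c * (phi x + M)).
rewrite LZ// bounded_RintegralZ// ler_pM2l// LD// Lcst.
rewrite bounded_RintegralD//; last exact: bounded_measurable_cst.
rewrite Rintegral_cst_prob lerD2r; apply; first exact: continuous_funZ.
move=> x; have := phiM x; rewrite ler_norml => /andP[x1 x2].
by rewrite pmulr_rge0// -[X in _ && (_ <= X)]cc ler_pM2l//; apply/andP; split; lra.
Qed.

(** Applying [L_le_Rintegral] to phi and to - phi turns the inequality into an equality. *)
Lemma riesz_representation : exists mu : probability (borel X) R,
  forall phi, continuous phi -> \int[mu]_x phi x = L phi.
Proof.
exists riesz_prob => phi cphi; apply/eqP; rewrite eq_le L_le_Rintegral// andbT.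
have := L_le_Rintegral (continuous_funN cphi).
rewrite bounded_RintegralN; last exact: continuous_bounded_measurable.
have -> : (fun x => - phi x) = (fun x => -1 * phi x).
  by apply/funext => x; rewrite mulN1r.
by rewrite LZ// mulN1r lerN2.
Qed.

End RieszRepresentation.

(** * The weak* topology *)

Section WeakStarTopology.
Context (R : realType) (X : pmetricType R).
Hypothesis compactX : compact [set: X].
Implicit Types (phi : X -> R) (mu nu : probability (borel X) R).

Local Notation W := (weak_star X).

Lemma continuous_integral phi : continuous phi ->
  continuous (fun mu : W => \int[mu : probability (borel X) R]_x phi x).
Proof.
move=> cphi.
have -> : (fun mu : W => \int[mu : probability (borel X) R]_x phi x) =
    (fun L : prod_topology (fun _ : continuousType X R => R) => L (mkcts cphi))
    \o (@integrals R X : W -> _) by [].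
move=> mu; apply: continuous_comp; first exact: initial_continuous.
exact: proj_continuous.
Qed.

(** Integration maps the probabilities into a product of segments, where the filter has a cluster
    point. That point is again a normalized positive linear functional, hence comes from a measure,
    and the initial topology carries the clustering back. *)
Lemma compact_weak_star : compact [set: W].
Proof.
move=> F FF _.
pose Y := prod_topology (fun _ : continuousType X R => R).
have bC (phi : continuousType X R) : exists M : R, forall x, `|phi x| <= M.
  by apply: compact_continuous_bounded => //; exact: cts_fun.
have [M MP] := choice bC.
have bm (phi : continuousType X R) : bounded_measurable (phi : borel X -> R).
  by apply: continuous_bounded_measurable => //; exact: cts_fun.
pose G : set_system Y := (@integrals R X : W -> Y) @ F.
have GK : G [set L : Y | forall phi : continuousType X R,
    `[- M phi, M phi]%classic (L phi)].
  apply: (@filterE _ F) => mu phi /=; rewrite in_itv /=; apply/andP; split.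
    rewrite -(Rintegral_cst_prob mu (- M phi)); apply: bounded_le_Rintegral => //.
      exact: bounded_measurable_cst.
    by move=> x; have := MP phi x; rewrite ler_norml => /andP[].
  rewrite -[leRHS](Rintegral_cst_prob mu); apply: bounded_le_Rintegral => //.
    exact: bounded_measurable_cst.
  by move=> x; have := MP phi x; rewrite ler_norml => /andP[].
have [L [_ clL]] := tychonoff (fun phi : continuousType X R =>
    @segment_compact R (- M phi) (M phi))
  (fmap_proper_filter (@integrals R X : W -> Y) FF) GK.
(* Linearity, monotonicity and normalization are closed conditions on functionals, so the cluster
   point inherits them. *)
have closedL (C : set Y) : closed C -> (forall mu, C (integrals mu)) -> C L.
  move=> cC Cint; apply: cC => B LB; apply: clL => //.
  by apply: (@filterE _ F) => mu; exact: Cint.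
have ev (phi : continuousType X R) : continuous (fun L' : Y => L' phi).
  exact: proj_continuous.
(* L is indexed by bundled continuous functions; the representation theorem takes a functional on
   all functions, and the value 0 off the continuous ones is arbitrary. *)
pose L' (phi : X -> R) : R :=
  if pselect (continuous phi) is left cphi then L (mkcts cphi) else 0.
have L'E phi (cphi : continuous phi) : L' phi = L (mkcts cphi).
  by rewrite /L'; case: pselect => // c; congr L; apply/continuousEP => x.
have [mu muL] : exists mu : probability (borel X) R,
    forall phi, continuous phi -> \int[mu]_x phi x = L' phi.
  apply: riesz_representation => //.
  - move=> phi psi c1 c2; have c3 := continuous_funD c1 c2.
    rewrite (L'E _ c1) (L'E _ c2) (L'E _ c3).
    apply: (@closedL [set L : Y | L (mkcts c3) = L (mkcts c1) + L (mkcts c2)]).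
      apply: closed_eq_continuous; first exact: ev.
      by apply: continuous_funD; exact: ev.
    move=> mu; apply: bounded_RintegralD; exact: continuous_bounded_measurable.
  - move=> c phi c1; have c2 := @continuous_funZ _ _ c _ c1.
    rewrite (L'E _ c1) (L'E _ c2).
    apply: (@closedL [set L : Y | L (mkcts c2) = c * L (mkcts c1)]).
      apply: closed_eq_continuous; first exact: ev.
      by apply: continuous_funZ; exact: ev.
    move=> mu; apply: bounded_RintegralZ; exact: continuous_bounded_measurable.
  - move=> phi psi c1 c2 le12; rewrite (L'E _ c1) (L'E _ c2) -subr_ge0.
    apply: (@closedL [set L : Y | 0 <= L (mkcts c2) - L (mkcts c1)]).
      by apply: closed_ge_continuous; apply: continuous_funB; exact: ev.
    move=> mu; rewrite /= subr_ge0; apply: bounded_le_Rintegral => //;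
      exact: continuous_bounded_measurable.
  - have c1 : continuous (fun _ : X => 1 : R) by move=> x; exact: cvg_cst.
    rewrite (L'E _ c1); apply: (@closedL [set L : Y | L (mkcts c1) = 1]).
      apply: closed_eq_continuous; first exact: ev.
      exact: cst_continuous.
    by move=> mu; exact: Rintegral_cst_prob.
have intmu : integrals mu = L.
  apply/funext => phi; rewrite /integrals muL; last exact: cts_fun.
  have cphi : continuous phi by exact: cts_fun.
  by rewrite (L'E _ cphi); congr L; exact/continuousEP.
exists (mu : W); split => // A B FA; rewrite nbhsE => -[B' [[V oV VB'] B'mu] B'B].
have OL : nbhs L V.
  by apply: open_nbhs_nbhs; split => //; rewrite -intmu; move: B'mu; rewrite -VB'.
have GA : G ((@integrals R X : W -> Y) @` A).
  by apply: (@filterS _ F _ A) FA => nu Anu; exists nu.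
have [_ [ [nu Anu <-] Onu]] := clL _ _ GA OL.
by exists nu; split => //; apply: B'B; rewrite -VB'.
Qed.

(* By compactness it is enough to identify the cluster points. *)
Lemma weak_star_cvg (T : Type) (F : set_system T) (E : T -> W) (mu : W) :
  Filter F ->
  (forall phi, continuous phi ->
    \int[E t : probability (borel X) R]_x phi x @[t --> F] -->
    \int[mu : probability (borel X) R]_x phi x) ->
  E @ F --> mu.
Proof.
move=> FF Ecvg; apply: contrapT => nE.
have [B oB [Bmu nFB]] : exists2 B : set W, open B & B mu /\ ~ F (E @^-1` B).
  apply: contrapT => nB; apply: nE => B /=; rewrite nbhsE => -[B' [oB' B'mu] B'B].
  apply: contrapT => nFB; apply: nB; exists B' => //; split => // FB'.
  by apply: nFB; apply: filterS FB' => t /B'B.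
have PF : ProperFilter F.
  by split => // F0; apply: nFB; apply: filterS F0.
apply: nFB; apply: (@cluster_sub_open W (E @ F)) => //.
  exact: compact_weak_star.
move=> nu clnu; case: oB Bmu => O oO <-; rewrite /preimage /=.
suff -> : integrals nu = integrals mu by [].
apply/funext => phi; have cphi : continuous phi by exact: cts_fun.
have ci := continuous_integral cphi.
apply/eqP; rewrite eq_le; apply/andP; split; apply/ler_addgt0Pr => e e0.
  apply: (cluster_le_near _ ci clnu).
  have /cvgrPdist_le/(_ e e0) := Ecvg _ cphi; apply: filterS => t.
  by rewrite ler_norml => /andP[h1 h2]; rewrite /preimage /integrals /=; lra.
rewrite -lerBlDr -lerN2.
apply: (@cluster_le_near _ _ _ _ _ nu _ (continuous_funN ci) clnu).
have /cvgrPdist_le/(_ e e0) := Ecvg _ cphi; apply: filterS => t.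
by rewrite ler_norml => /andP[h1 h2]; rewrite /preimage /integrals /=; lra.
Qed.

End WeakStarTopology.

(** * Cluster points of empirical measures *)

Section LimfPositive.
Context (T : choiceType) (Y : filteredType T) (R : realType).
Implicit Types (F : set (set Y)) (u : Y -> R).

(** A positive lower limit is a positive real constant bounding u from below on a set of the filter;
    here and in [limf_esup_gt0], extended reals leave the study of densities. *)
Lemma limf_einf_gt0 F u : (0 < limf_einf (fun t => (u t)%:E) F)%E <->
  exists2 c : R, 0 < c & exists2 V, F V & forall t, V t -> c <= u t.
Proof.
rewrite limf_einfE; split => [/ereal_sup_gt[_ [V FV <-]] V0|[c c0 [V FV Vc]]].
  suff [c c0 cV] : exists2 c : R, 0 < c &
      (c%:E <= ereal_inf [set (u t)%:E | t in V])%E.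
    exists c => //; exists V => // t Vt; rewrite -lee_fin (le_trans cV)//.
    by apply: ereal_inf_lbound; exists t.
  move: (ereal_inf _) V0 => [r| |] //=; first by rewrite lte_fin => r0; exists r.
  by move=> _; exists 1 => //; rewrite leey.
apply: (@lt_le_trans _ _ c%:E); first by rewrite lte_fin.
apply: (@le_trans _ _ (ereal_inf [set (u t)%:E | t in V])); last first.
  by apply: ereal_sup_ubound; exists V.
by apply: le_ereal_inf_tmp => _ [t Vt <-]; rewrite lee_fin Vc.
Qed.

Lemma limf_esup_gt0 F u : (0 < limf_esup (fun t => (u t)%:E) F)%E <->
  exists2 c : R, 0 < c & forall V, F V -> exists2 t, V t & c <= u t.
Proof.
rewrite limf_esupE; split => [u0|[c c0 Fc]].
  have [c c0 cu] : exists2 c : R, 0 < c &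
      (c%:E < ereal_inf [set ereal_sup [set (u t)%:E | t in V] | V in F])%E.
    move: (ereal_inf _) u0 => [r| |] //=; last by move=> _; exists 1; rewrite ?ltry.
    by rewrite lte_fin => r0; exists (r / 2); rewrite ?lte_fin; lra.
  exists c => // V FV.
  have : (c%:E < ereal_sup [set (u t)%:E | t in V])%E.
    by apply: (lt_le_trans cu); apply: ereal_inf_lbound; exists V.
  by move=> /ereal_sup_gt[_ [t Vt <-]]; rewrite lte_fin => /ltW; exists t.
apply: (@lt_le_trans _ _ c%:E); first by rewrite lte_fin.
apply: le_ereal_inf_tmp => _ [V FV <-]; have [t Vt cu] := Fc _ FV.
apply: (@le_trans _ _ (u t)%:E); first by rewrite lee_fin.
by apply: ereal_sup_ubound; exists t.
Qed.

End LimfPositive.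

Section EmpiricalMeasures.
Context (R : realType) (X : pmetricType R).
Hypothesis compactX : compact [set: X].
Variable f : X -> X.
Implicit Types (phi : X -> R) (x y : X).

Definition orbit_average phi x (a b : nat) : R :=
  (\sum_(a <= i < b) phi (iter i f x)) / (b - a)%N%:R.

Lemma empirical_measureE x a b (A : set (borel X)) : (a < b)%N ->
  empirical f x a b A =
  ((b - a)%N%:R^-1%:E *
    msum (fun j => \d_(iter (a + j) f x : borel X)) (b - a) A)%E.
Proof.
move=> ab; pose m : {measure set (borel X) -> \bar R} :=
  msum (fun j => \d_(iter (a + j) f x : borel X)) (b - a).
have mT : m setT = (b - a)%N%:R%:E :> \bar R.
  rewrite /m /= /msum (eq_bigr (fun=> 1%:E)); last by move=> i _; rewrite /= diracT.
  by rewrite sumEFin sumr_const card_ord.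
change (mnormalize m \d_(x : borel X) A = ((b - a)%N%:R^-1%:E * m A)%E).
rewrite /mnormalize mT.
by rewrite eqe pnatr_eq0 subn_eq0 leqNgt ab /= muleC.
Qed.

Lemma integral_empirical phi x a b : continuous phi -> (a < b)%N ->
  \int[empirical f x a b]_y phi y = orbit_average phi x a b.
Proof.
move=> cphi ab; have ba0 : (b - a)%N%:R != 0 :> R.
  by rewrite pnatr_eq0 subn_eq0 -ltnNge.
have ge0 (psi : X -> R) : continuous psi -> (forall y, 0 <= psi y) ->
    \int[empirical f x a b]_y psi y = orbit_average psi x a b.
  move=> cpsi psi0.
  have mpsi : measurable_fun setT (EFin \o psi : borel X -> \bar R).
    by apply/measurable_EFinP; exact: continuous_borel_measurable.
  have k0 : 0 <= (b - a)%N%:R^-1 :> R by rewrite invr_ge0.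
  rewrite /Rintegral (@eq_measure_integral _ _ _ setT
    (mscale (NngNum k0) (msum (fun j => \d_(iter (a + j) f x : borel X)) (b - a)))).
    rewrite ge0_integral_mscale//; last by move=> y _; rewrite lee_fin.
    rewrite ge0_integral_measure_sum//; last by move=> y _; rewrite lee_fin.
    rewrite (eq_bigr (fun j : 'I_(b - a) => (psi (iter (a + j) f x))%:E)).
      rewrite sumEFin -EFinM /= /orbit_average mulrC; congr (_ / _).
      rewrite -[X in \sum_(X <= _ < _) _](add0n a) big_addn big_mkord.
      by apply: eq_bigr => i _; rewrite addnC.
    by move=> j _; rewrite integral_dirac//= diracT mul1e.
  by move=> A mA _; exact: empirical_measureE.
(* The nonnegative case extends to phi by adding a bound M and cancelling it on both sides. *)
have [M phiM] := compact_continuous_bounded compactX cphi.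
have cM : continuous (fun y => phi y + M).
  by apply: continuous_funD => // y; exact: cvg_cst.
have := ge0 _ cM; rewrite bounded_RintegralD; last 2 first.
- exact: continuous_bounded_measurable.
- exact: bounded_measurable_cst.
rewrite Rintegral_cst_prob /orbit_average big_split /= mulrDl.
rewrite sumr_const_nat -[M *+ (b - a)]mulr_natr mulfK//.
move=> e; apply: (addIr M); apply: e => y.
by have := phiM y; rewrite ler_norml; lra.
Qed.

Lemma orbit_average_le phi psi x a b : (forall y, phi y <= psi y) ->
  orbit_average phi x a b <= orbit_average psi x a b.
Proof.
move=> pp; rewrite ler_wpM2r ?invr_ge0//; apply: ler_sum => i _; exact: pp.
Qed.

Lemma orbit_averageZ (c : R) phi x a b :
  orbit_average (fun y => c * phi y) x a b = c * orbit_average phi x a b.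
Proof. by rewrite /orbit_average -mulr_sumr mulrA. Qed.

Lemma frequencyE x (U : set X) a b :
  frequency R (visits f x U) a b = orbit_average \1_U x a b.
Proof.
rewrite /frequency /orbit_average natr_sum; congr (_ / _).
Qed.

(** * Cluster measures along an arbitrary filter of time intervals *)

Section Filter.
Variable F : set_system (nat * nat).
Hypothesis FF : ProperFilter F.
Hypothesis F_lt : \forall I \near F, (I.1 < I.2)%N.

Definition empirical_cluster x : set (probability (borel X) R) :=
  cluster ((fun I => empirical f x I.1 I.2 : weak_star X) @ F).

Lemma empirical_cluster_lt x phi (c : R) : continuous phi ->
  (forall mu, empirical_cluster x mu -> \int[mu]_y phi y < c) ->
  exists2 c', c' < c & \forall I \near F, orbit_average phi x I.1 I.2 <= c'.
Proof.
move=> cphi clc.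
have [c' c'c Fc'] := cluster_lt_near (compact_weak_star compactX)
  _ (continuous_integral cphi) clc.
exists c' => //.
have Fc : F [set I | \int[empirical f x I.1 I.2]_y phi y <= c'] by exact: Fc'.
by apply: filterS2 Fc F_lt => I /= h lt; rewrite -integral_empirical.
Qed.

Lemma empirical_cluster_le x phi (c : R) mu : continuous phi ->
  empirical_cluster x mu ->
  (\forall I \near F, orbit_average phi x I.1 I.2 <= c) -> \int[mu]_y phi y <= c.
Proof.
move=> cphi clmu Fc; apply: (cluster_le_near _ (continuous_integral cphi) clmu).
by apply: filterS2 Fc F_lt => I h lt; rewrite /preimage /= integral_empirical.
Qed.

Lemma empirical_cluster_nonempty x : empirical_cluster x !=set0.
Proof.
have [mu [_ clmu]] := compact_weak_star compactX _
  (@filterT _ ((fun I => empirical f x I.1 I.2 : weak_star X) @ F) _).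
by exists mu.
Qed.

(** Upper bounds on averages of the negated tent are lower bounds on visits. If every cluster
    measure charges the tent, the uniform gap of [empirical_cluster_lt] is the constant c;
    conversely a frequency c of visits to the half ball forces every cluster measure to give the
    tent at least c / 2. *)
Lemma bigcap_msupport_frequency x y :
  (\bigcap_(mu in empirical_cluster x) msupport mu) y <->
  forall e : R, 0 < e -> exists2 c : R, 0 < c &
    exists2 V, F V & forall I, V I ->
      c <= frequency R (visits f x (ball y e)) I.1 I.2.
Proof.
split => [Sy e e0|Fy mu clmu].
  have [|c c0 Fc] := @empirical_cluster_lt x (fun z => - tent y e z) 0
      (continuous_funN (@continuous_tent _ _ y e)).
    move=> mu clmu; rewrite bounded_RintegralN; last exact: bounded_measurable_tent.
    by rewrite oppr_lt0; have /msupport_tent := Sy _ clmu; exact.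
  exists (- c); first lra.
  exists [set I | orbit_average (fun z => - tent y e z) x I.1 I.2 <= c] => //.
  move=> I /= h; rewrite lerNl (le_trans _ h)// frequencyE -mulN1r -orbit_averageZ.
  by apply: orbit_average_le => z; rewrite mulN1r lerN2 tent_le_indic.
apply/msupport_tent => // e e0.
have e20 : 0 < e / 2 by rewrite divr_gt0.
have [c c0 [V FV Vc]] := Fy _ e20.
have := @empirical_cluster_le x (fun z => - tent y e z) (- (c / 2)) mu
  (continuous_funN (@continuous_tent _ _ y e)) clmu.
rewrite bounded_RintegralN; last exact: bounded_measurable_tent.
suff h : \forall I \near F,
    orbit_average (fun z => - tent y e z) x I.1 I.2 <= - (c / 2).
  by move/(_ h); lra.
apply: filterS FV => I /Vc; rewrite frequencyE => cI.
apply: (@le_trans _ _ (orbit_average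
  (fun z => - 2^-1 * \1_(ball y (e / 2)) z) x I.1 I.2)).
  by apply: orbit_average_le => z; rewrite mulNr lerN2 indic_half_le_tent.
by rewrite orbit_averageZ; lra.
Qed.

Lemma closure_bigcup_msupport_frequency x y :
  closure (\bigcup_(mu in empirical_cluster x) msupport mu) y <->
  forall e : R, 0 < e -> exists2 c : R, 0 < c &
    forall V, F V -> exists2 I, V I &
      c <= frequency R (visits f x (ball y e)) I.1 I.2.
Proof.
split => [/(closure_msupport_tent compactX) Sy e e0|Fy].
  have [mu clmu mu0] := Sy e e0.
  set m := \int[mu]_z tent y e z in mu0.
  exists (m / 2); first lra.
  move=> V FV; apply: contrapT => nV.
  suff : m <= m / 2 by lra.
  apply: (empirical_cluster_le (@continuous_tent _ _ y e) clmu).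
  apply: filterS FV => I VI; rewrite leNgt; apply/negP => mI; apply: nV.
  exists I => //; rewrite frequencyE (le_trans (ltW mI))//.
  by apply: orbit_average_le => z; exact: tent_le_indic.
apply/(closure_msupport_tent compactX) => e e0.
have e20 : 0 < e / 2 by rewrite divr_gt0.
have [c c0 Fc] := Fy _ e20.
apply: contrapT => nmu.
(* If no cluster measure charged the tent, its averages would stay below c / 2 along F, while
   frequencies at least c for the half ball keep recurring and push them up to c / 2. *)
have [|c' c'c Fc'] := @empirical_cluster_lt x (tent y e) (c / 2) (@continuous_tent _ _ y e).
  move=> mu clmu; apply: (@le_lt_trans _ _ 0); last lra.
  by rewrite leNgt; apply/negP => m0; apply: nmu; exists mu.
have [I /= Ic' cI] := Fc _ Fc'.
have : 2^-1 * orbit_average \1_(ball y (e / 2)) x I.1 I.2 <=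
    orbit_average (tent y e) x I.1 I.2.
  by rewrite -orbit_averageZ; apply: orbit_average_le => z; exact: indic_half_le_tent.
by rewrite frequencyE in cI; lra.
Qed.

End Filter.

End EmpiricalMeasures.

(** * Separating families and invariant measures *)

Section SeparatingFamily.
Context (R : realType) (X : pmetricType R).
Hypothesis compactX : compact [set: X].
Implicit Types (phi : X -> R) (mu nu : probability (borel X) R).

Lemma finite_partition_of_unity (e : R) : 0 < e ->
  exists (n : nat) (c : nat -> X) (p : nat -> X -> R),
    [/\ forall i, continuous (p i), forall i x, 0 <= p i x,
        forall i x, 0 < p i x -> mdist (c i) x < e &
        forall x, \sum_(i < n) p i x = 1].
Proof.
move=> e0; have [s sP] := finite_net compactX e0.
pose S x := \sum_(i < size s) tent (nth point s i) e x.
have S0 x : 0 < S x.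
  have [z zs zx] := sP x.
  have zi : (index z s < size s)%N by rewrite index_mem.
  rewrite /S (bigD1 (Ordinal zi))//= nth_index// ltr_pwDl//.
    by apply/tent_gt0 => //; exact/mem_ball.
  by apply: sumr_ge0 => i _; exact: tent_ge0.
have cS : continuous S.
  by apply: continuous_fun_sum => i; exact: continuous_tent.
exists (size s), (fun i => nth point s i),
  (fun i x => tent (nth point s i) e x * (S x)^-1); split.
- move=> i; apply: continuous_funM; first exact: continuous_tent.
  by apply: continuous_funV => // x; rewrite gt_eqF.
- by move=> i x; rewrite mulr_ge0 ?tent_ge0// invr_ge0 ltW.
- move=> i x; rewrite pmulr_lgt0 ?invr_gt0// => ix.
  by apply/mem_ball/tent_gt0.
- by move=> x; rewrite -mulr_suml -/(S x) divff// gt_eqF.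
Qed.

(** Take partitions of unity of mesh 1/(n+1) for all n. By uniform continuity phi is uniformly close
    to the sum of the phi (c i) p i, so finitely many integrals determine that of phi up to e,
    uniformly in the measures. *)
Lemma countable_separating_family : exists p : nat -> X -> R,
  (forall j, continuous (p j)) /\
  forall phi, continuous phi -> forall e : R, 0 < e ->
  exists (N : nat) (d : R), 0 < d /\ forall mu nu,
    (forall j, (j < N)%N -> `|\int[mu]_x p j x - \int[nu]_x p j x| <= d) ->
    `|\int[mu]_x phi x - \int[nu]_x phi x| <= e.
Proof.
have eps0 n : 0 < (n.+1%:R^-1 : R) by rewrite invr_gt0.
have /choice[P PP] : forall n, exists P : nat * (nat -> X) * (nat -> X -> R),
    [/\ forall i, continuous (P.2 i), forall i x, 0 <= P.2 i x,
        forall i x, 0 < P.2 i x -> mdist (P.1.2 i) x < n.+1%:R^-1 &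
        forall x, \sum_(i < P.1.1) P.2 i x = 1].
  by move=> n; have [m [c [p ?]]] := finite_partition_of_unity (eps0 n); exists (m, c, p).
exists (fun j => if unpickle j is Some (n, i) then (P n).2 i else fun=> 0); split.
  move=> j; case: (unpickle j : option (nat * nat)) => [[n i]|].
    by case: (PP n).
  by move=> x; exact: cvg_cst.
move=> phi cphi e e0; have e30 : 0 < e / 3 by rewrite divr_gt0.
have [d d0 unif] := uniform_continuity compactX cphi e30.
have [n nd] : exists n : nat, n.+1%:R^-1 < d.
  by have [n _ /(_ _ (leqnn n))/= ] := near_infty_natSinv_lt (PosNum d0); exists n.
have := PP n; case Pn : (P n) => [[m c] p] [/= cp p0 pc p1].
pose approx x := \sum_(i < m) phi (c i) * p i x.
have capprox : continuous approx.
  by apply: continuous_fun_sum => i; exact: continuous_funZ.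
have near_approx x : `|phi x - approx x| <= e / 3.
  have -> : phi x - approx x = \sum_(i < m) (phi x - phi (c i)) * p i x.
    rewrite -[X in X - _]mulr1 -(p1 x) mulr_sumr -sumrB.
    by apply: eq_bigr => i _; rewrite mulrBl.
  apply: (le_trans (ler_norm_sum _ _ _)).
  rewrite -[leRHS]mulr1 -[X in _ <= _ * X](p1 x) mulr_sumr; apply: ler_sum => i _.
  rewrite normrM (ger0_norm (p0 i x)).
  have := p0 i x; rewrite le_eqVlt => /predU1P[<-|pi0]; first by rewrite !mulr0.
  rewrite ler_wpM2r// distrC; apply: ltW; apply: unif.
  by apply: lt_trans nd; exact: pc.
pose K : R := \sum_(i < m) `|phi (c i)|.
have K0 : 0 <= K by exact: sumr_ge0.
(* The first number exceeds the codes of all functions of the n-th partition; K + 1 is positive even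
   if phi vanishes at all centres. *)
exists (\max_(i < m) pickle (n, i : nat)).+1, (e / 3 / (K + 1)).
split; first by rewrite !divr_gt0//; lra.
move=> mu nu h.
have bp i : bounded_measurable (p i : borel X -> R).
  exact: continuous_bounded_measurable.
have bphi := continuous_bounded_measurable compactX cphi.
have ba := continuous_bounded_measurable compactX capprox.
have close (la : probability (borel X) R) :
    `|\int[la]_x phi x - \int[la : probability (borel X) R]_x approx x| <= e / 3.
  rewrite -bounded_RintegralB//.
  have bB := bounded_measurableB bphi ba.
  rewrite ler_norml -{1}(Rintegral_cst_prob la (- (e / 3))).
  rewrite -[X in _ && (_ <= X)](Rintegral_cst_prob la (e / 3)).
  apply/andP; split; apply: bounded_le_Rintegral => //; try exact: bounded_measurable_cst.
    by move=> x; have := near_approx x; rewrite ler_norml => /andP[].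
  by move=> x; have := near_approx x; rewrite ler_norml => /andP[].
have mid : `|\int[mu]_x approx x - \int[nu]_x approx x| <= e / 3.
  have int_approx (la : probability (borel X) R) :
      \int[la : probability (borel X) R]_x approx x =
      \sum_(i < m) phi (c i) * \int[la]_x p i x.
    rewrite bounded_Rintegral_sum; last by move=> i; exact: bounded_measurableZ.
    by apply: eq_bigr => i _; exact: bounded_RintegralZ.
  rewrite !int_approx -sumrB.
  apply: (le_trans (ler_norm_sum _ _ _)).
  apply: (@le_trans _ _ (\sum_(i < m) `|phi (c i)| * (e / 3 / (K + 1)))).
    apply: ler_sum => i _; rewrite -mulrBr normrM ler_wpM2l//.
    have := h (pickle (n, i : nat)); rewrite pickleK Pn /=; apply.
    by rewrite ltnS; apply: (leq_bigmax i).
  rewrite -mulr_suml.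
  have -> : K * (e / 3 / (K + 1)) = e / 3 * (K / (K + 1)).
    by rewrite mulrCA mulrA.
  by rewrite ler_piMr ?(ltW e30)// ler_pdivrMr; lra.
have := close mu; have := close nu; move: mid.
by rewrite !ler_norml; lra.
Qed.

End SeparatingFamily.

Section InvariantMeasures.
Context (R : realType) (X : pmetricType R) (f : X -> X).
Hypothesis compactX : compact [set: X].
Hypothesis cf : continuous f.
Implicit Types (phi psi : X -> R) (mu nu : probability (borel X) R) (x : X).

Let mf := continuous_borel_measurable_self cf.

Let fB : borel X -> borel X := f.

HB.instance Definition _ := isMeasurableFun.Build _ _ (borel X) (borel X) fB mf.

Let borel_f : {mfun borel X >-> borel X} := fB.

Lemma invariant_Rintegral mu (g : borel X -> R) : invariant_measure f mu ->
  bounded_measurable g -> \int[mu]_x g (f x) = \int[mu]_x g x.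
Proof.
move=> inv bg; rewrite /Rintegral; congr fine.
transitivity (\int[distribution mu borel_f]_x (g x)%:E)%E.
  rewrite integral_distribution//; first by apply/measurable_EFinP; case: bg.
  have := bounded_measurable_integrable mu (bounded_measurable_comp mf bg).
  exact.
by apply: eq_measure_integral => A mA _; exact: inv.
Qed.

(** The measure and its image under f have the same integrals of continuous functions, hence
    coincide on Borel sets. *)
Lemma invariant_measure_continuous mu :
  (forall phi, continuous phi -> \int[mu]_x phi (f x) = \int[mu]_x phi x) ->
  invariant_measure f mu.
Proof.
move=> inv A mA.
apply: (continuous_Rintegral_inj compactX (mu := distribution mu borel_f)) => // phi cphi.
have bphi := continuous_bounded_measurable compactX cphi.
rewrite -inv// /Rintegral integral_distribution//.
  by apply/measurable_EFinP; case: bphi.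
have := bounded_measurable_integrable mu (bounded_measurable_comp mf bphi).
exact.
Qed.

Lemma continuous_iter n : continuous (iter n f).
Proof.
elim: n => [|n ih] x; first exact: cvg_id.
by apply: continuous_comp; [exact: ih|exact: cf].
Qed.

Lemma invariant_Rintegral_iter mu n phi : invariant_measure f mu ->
  continuous phi -> \int[mu]_x phi (iter n f x) = \int[mu]_x phi x.
Proof.
move=> inv cphi; elim: n => // n <-.
rewrite -[RHS]invariant_Rintegral//.
  by apply: eq_Rintegral => x _; rewrite iterSr.
apply: continuous_bounded_measurable => // x.
by apply: (@continuous_comp _ _ _ (iter n f) phi); [exact: continuous_iter|exact: cphi].
Qed.

Lemma invariant_msupport mu : invariant_measure f mu ->
  invariant_set f (msupport mu).
Proof.
move=> inv _ [x Sx <-] U [oU Ux].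
rewrite -inv; last exact: open_borel_measurable.
apply: Sx; split => //; move/continuousP: cf; exact.
Qed.

(** With psi vanishing exactly on a closed set Y, being carried by Y becomes an equation between
    integrals, which is stable under weak* limits. *)
Lemma measure_zero_set mu psi : continuous psi -> (forall x, 0 <= psi x) ->
  \int[mu]_x psi x = 0 <-> mu [set x | psi x = 0] = 1%E.
Proof.
move=> cpsi psi0; have bpsi := continuous_bounded_measurable compactX cpsi.
have mZ : measurable ([set x | psi x = 0] : set (borel X)).
  apply: closed_borel_measurable; apply: closed_eq_continuous => // x.
  exact: cvg_cst.
split => [int0|muZ]; last first.
  apply/eqP; rewrite eq_le Rintegral_ge0// andbT.
  by apply: bounded_le_Rintegral_full mZ muZ _ => // x ->.
suff : mu (~` [set x | psi x = 0]) = 0%E.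
  move=> Z0; rewrite -[[set x | _]]setCK probability_setC ?Z0 ?sube0//.
  exact: measurableC.
apply/eqP; rewrite eq_le measure_ge0 andbT leNgt; apply/negP.
move=> /(Rintegral_gt0_measure bpsi (measurableC mZ)); rewrite int0 ltxx.
move/(_ _ psi0); suff h : forall x, ~ psi x = 0 -> 0 < psi x by move/(_ h).
by move=> x px; rewrite lt_neqAle psi0 andbT; apply/eqP => /esym.
Qed.

End InvariantMeasures.

(** * Empirical measures along long intervals *)

Section LongIntervals.
Context (R : realType) (X : pmetricType R) (f : X -> X).
Hypothesis compactX : compact [set: X].
Hypothesis cf : continuous f.
Implicit Types (phi psi : X -> R) (mu nu : probability (borel X) R) (x y z : X).

Lemma long_intervals_proper : ProperFilter long_intervals.
Proof.
apply: filter_from_proper.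
  apply: filter_from_filter; first by exists 0.
  move=> m n _ _; exists (maxn m n) => // I /=.
  by rewrite geq_max => /andP[].
by move=> n _; exists (0, n) => /=; rewrite subn0.
Qed.

Local Instance long_intervals_proper_filter : ProperFilter long_intervals :=
  long_intervals_proper.

Lemma near_long_intervals (P : nat * nat -> Prop) (n : nat) :
  (forall I, (n <= I.2 - I.1)%N -> P I) -> \forall I \near long_intervals, P I.
Proof. by move=> nP; exists n => // I /=; exact: nP. Qed.

Lemma long_intervals_lt : \forall I \near long_intervals, (I.1 < I.2)%N.
Proof. by apply: (@near_long_intervals _ 1) => I; rewrite subn_gt0. Qed.

Local Notation V x := (empirical_cluster f long_intervals x).

(** An error C independent of the interval costs at most e in the average once the length exceeds C
    / e, wherever the interval lies. *)
Lemma long_interval_average_le x phi (C e : R) : 0 < e ->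
  (forall a b, (a < b)%N ->
    \sum_(a <= i < b) phi (iter i f x) <= C + e * (b - a)%N%:R) ->
  \forall I \near long_intervals, orbit_average f phi x I.1 I.2 <= e + e.
Proof.
move=> e0 phiC; have [n Cn] : exists n : nat, C / e <= n%:R.
  by exists (Num.truncn (C / e)).+1; rewrite ltW// truncnS_gt.
apply: (@near_long_intervals _ n.+1) => -[a b] /= nab.
have ab : (a < b)%N by rewrite -subn_gt0 (leq_trans _ nab).
have ba0 : 0 < (b - a)%N%:R :> R by rewrite ltr0n subn_gt0.
rewrite /orbit_average ler_pdivrMr// mulrDl (le_trans (phiC _ _ ab))// lerD2r.
rewrite -ler_pdivrMl// mulrC (le_trans Cn)// ler_nat.
exact: ltnW.
Qed.

(** The sum of phi o f - phi along an orbit segment telescopes and is at most 2M, so its average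
    over long intervals vanishes in the limit; the opposite sign is treated alike. *)
Lemma empirical_cluster_invariant x mu : V x mu -> invariant_measure f mu.
Proof.
move=> Vmu; apply: invariant_measure_continuous => // phi cphi.
have [M phiM] := compact_continuous_bounded compactX cphi.
have cphif : continuous (fun y => phi (f y)).
  by move=> y; apply: (@continuous_comp _ _ _ f phi); [exact: cf|exact: cphi].
have bphi := continuous_bounded_measurable compactX cphi.
have bphif := continuous_bounded_measurable compactX cphif.
have telescope a b : (a < b)%N ->
    \sum_(a <= i < b) (phi (f (iter i f x)) - phi (iter i f x)) =
    phi (iter b f x) - phi (iter a f x).
  move=> ab; rewrite -(telescope_sumr (fun i => phi (iter i f x)) (ltnW ab)).
  by apply: eq_bigr.
have bound a b : phi (iter b f x) - phi (iter a f x) <= M + M.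
  have := phiM (iter b f x); have := phiM (iter a f x).
  by rewrite !ler_norml; lra.
have half psi : continuous psi ->
    (forall a b, (a < b)%N -> \sum_(a <= i < b) psi (iter i f x) <= M + M) ->
    \int[mu]_y psi y <= 0.
  move=> cpsi psiM; apply/ler_addgt0Pr => e e0; rewrite add0r.
  apply: (empirical_cluster_le compactX _ long_intervals_lt cpsi Vmu).
  have e20 : 0 < e / 2 by rewrite divr_gt0.
  rewrite (splitr e).
  apply: (@long_interval_average_le _ _ (M + M) _ e20) => a b ab.
  by rewrite (le_trans (psiM _ _ ab))// lerDl mulr_ge0// ltW.
have h1 := half _ (continuous_funB cphif cphi).
have h2 := half _ (continuous_funB cphi cphif).
rewrite !bounded_RintegralB// in h1 h2.
apply/eqP; rewrite eq_le -subr_le0 h1; last by move=> a b ab; rewrite telescope.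
rewrite -subr_le0 h2// => a b ab.
have -> : \sum_(a <= i < b) (phi (iter i f x) - phi (f (iter i f x))) =
    - \sum_(a <= i < b) (phi (f (iter i f x)) - phi (iter i f x)).
  by rewrite -sumrN; apply: eq_bigr => i _; rewrite opprB.
by rewrite telescope// opprB.
Qed.

Lemma closed_omega_limit x : closed (omega_limit f x).
Proof. by apply: closed_bigI => n _; exact: closed_closure. Qed.

Lemma omega_limit_recurrent x z (U : set X) (n : nat) : omega_limit f x z ->
  nbhs z U -> exists2 k, (n <= k)%N & U (iter k f x).
Proof.
move=> oz Uz; have [_ [[k nk ->] Uk]] := oz n.+1 isT _ Uz.
by exists k => //; exact: ltnW.
Qed.

(** All cluster points of the sequence of iterates belong to [omega_limit], so [cluster_lt_near]
    applies. *)
Lemma omega_limit_attracts x psi (e : R) : continuous psi ->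
  (forall z, omega_limit f x z -> psi z < e) ->
  exists n, forall k, (n <= k)%N -> psi (iter k f x) <= e.
Proof.
move=> cpsi psie.
have [|c ce [n _ nc]] := @cluster_lt_near _ _
    ((fun k => iter k f x) @ \oo) psi e compactX _ cpsi.
  move=> z clz; apply: psie => n _ U Uz.
  have tail : \forall k \near \oo, [set y | exists2 k, (n <= k)%N & y = iter k f x]
      (iter k f x).
    by exists n => // k nk; exists k.
  have [_ [[k nk ->] Uk]] := clz _ _ tail Uz.
  by exists (iter k f x); split => //; exists k.
by exists n => k /nc /le_trans -> //; exact: ltW.
Qed.

Lemma sum_lt_minn a b n : (\sum_(a <= i < b) (i < n)%N <= n)%N.
Proof.
rewrite (@leq_trans (minn b n))// ?geq_minr//.
elim: b => [|b ih]; first by rewrite big_geq.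
have [ab|ba] := leqP a b; last by rewrite big_geq.
rewrite big_nat_recr//=; move: (\sum_(a <= i < b) _)%N ih => S ih.
by case: (ltnP b n) => bn /=; lia.
Qed.

(** Let psi be the distance to the omega-limit set. After some time n it is at most e / 2 along the
    orbit, and the earlier times add at most M n to any sum, whatever the interval; hence psi has
    integral 0. *)
Lemma empirical_cluster_omega_limit x mu :
  V x mu -> inv_measures f (omega_limit f x) mu.
Proof.
move=> Vmu; split; first exact: empirical_cluster_invariant Vmu.
have [psi [cpsi psi0 psiO]] := closed_zero_set (@closed_omega_limit x).
have -> : omega_limit f x = [set y | psi y = 0].
  by apply/seteqP; split => y /psiO.
apply/(measure_zero_set compactX mu cpsi psi0).
apply/eqP; rewrite eq_le Rintegral_ge0// andbT; apply/ler_addgt0Pr => e e0.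
rewrite add0r [leRHS]splitr; have e20 : 0 < e / 2 by rewrite divr_gt0.
have [M psiM] := compact_continuous_bounded compactX cpsi.
have [|n psin] := @omega_limit_attracts x psi (e / 2) cpsi.
  by move=> z /psiO ->.
apply: (empirical_cluster_le compactX _ long_intervals_lt cpsi Vmu).
apply: (@long_interval_average_le _ _ (M * n%:R) _ e20) => a b ab.
apply: (@le_trans _ _ (\sum_(a <= i < b) (M * (i < n)%N%:R + e / 2))).
  apply: ler_sum => i _; have [ni|ni] := ltnP i n.
    have := psiM (iter i f x); have := ler_norm (psi (iter i f x)).
    by rewrite mulr1; lra.
  by rewrite mulr0 add0r psin.
rewrite big_split /= sumr_const_nat -[e / 2 *+ _]mulr_natr lerD2r -mulr_sumr -natr_sum.
rewrite ler_wpM2l ?ler_nat ?sum_lt_minn//.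
by rewrite (le_trans _ (psiM x)).
Qed.

(** A sequence has to be extracted from a cluster point of a filter: the k-th interval is longer
    than k and its empirical measure agrees with mu up to 1/(k+1) on the first k+1 functions of the
    separating family. Invariance is automatic along long intervals. *)
Lemma Vstar_fE x : Vstar_f f x = V x.
Proof.
apply/seteqP; split => mu.
  move=> [_ [a [b [ab cv]]]] A B VA Bmu.
  have [n _ nA] : long_intervals [set I | A (empirical f x I.1 I.2)] by exact: VA.
  have abn : \forall k \near \oo, (n <= b k - a k)%N.
    by apply: (ab [set m | (n <= m)%N]); exists n.
  have [k [nk Bk]] : exists k, (n <= b k - a k)%N /\ B (empirical f x (a k) (b k)).
    by apply: (@filter_ex _ \oo); apply: filterS2 abn (cv _ Bmu).
  by exists (empirical f x (a k) (b k)); split => //; exact: (nA (a k, b k)).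
move=> Vmu; have [inv _] := empirical_cluster_omega_limit Vmu.
split; first by split => //; rewrite probability_setT.
have [p [cp sep]] := countable_separating_family compactX.
have /choice[I IP] : forall k : nat, exists I : nat * nat, (k < I.2 - I.1)%N /\
    forall j, (j < k.+1)%N ->
      `|\int[empirical f x I.1 I.2]_y p j y - \int[mu]_y p j y| <= k.+1%:R^-1.
  move=> k; pose W : set (weak_star X) :=
    [set nu | forall j : 'I_k.+1,
      `|\int[nu : probability (borel X) R]_y p j y - \int[mu]_y p j y| <= k.+1%:R^-1].
  have Wmu : nbhs (mu : weak_star X) W.
    pose D (j : 'I_k.+1) : set (weak_star X) := [set nu |
      `|\int[nu : probability (borel X) R]_y p j y - \int[mu]_y p j y| <=
        k.+1%:R^-1].
    apply: (@filter_forall _ _ D (nbhs (mu : weak_star X)) _) => j.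
    have k0 : 0 < k.+1%:R^-1 :> R by rewrite invr_gt0.
    have /cvgrPdist_le/(_ _ k0) := @continuous_integral _ _ _ (cp j) mu.
    by apply: filterS => nu; rewrite distrC.
  have Vk : ((fun I => empirical f x I.1 I.2 : weak_star X) @ long_intervals)
      [set nu | exists2 I : nat * nat, (k < I.2 - I.1)%N & nu = empirical f x I.1 I.2].
    by apply: (@near_long_intervals _ k.+1) => I kI; exists I.
  have [_ [[I kI ->] WI]] := Vmu _ _ Vk Wmu.
  by exists I; split => // j jk; exact: (WI (Ordinal jk)).
exists (fun k => (I k).1), (fun k => (I k).2); split.
  move=> A [n _ nA]; exists n => // k nk; apply: nA => /=.
  by rewrite (leq_trans nk)//; have [/ltnW] := IP k.
apply: weak_star_cvg => // phi cphi; apply/cvgrPdist_le => e e0.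
have [N [d [d0 Nd]]] := sep _ cphi _ e0.
have := near_infty_natSinv_lt (PosNum d0).
move=> [m _ md]; exists (maxn N m) => // k /=; rewrite geq_max => /andP[Nk mk].
rewrite distrC; apply: Nd => j jN; have [_ /(_ j)] := IP k.
move=> /(_ _)/le_trans; apply; first by rewrite ltnS ltnW// (leq_trans jN).
exact: ltW (md _ mk).
Qed.

Lemma orbit_average_shift phi x m n :
  orbit_average f phi x m (m + n) = orbit_average f phi (iter m f x) 0 n.
Proof.
rewrite /orbit_average addKn subn0; congr (_ / _).
rewrite -[X in \sum_(X <= _ < _) _](add0n m) big_addn addKn.
by apply: eq_bigr => i _; rewrite iterD.
Qed.

Lemma continuous_orbit_average phi n : continuous phi ->
  continuous (fun x => orbit_average f phi x 0 n).
Proof.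
move=> cphi; rewrite /orbit_average; apply: continuous_funM => [|x]; last first.
  exact: cvg_cst.
apply: continuous_fun_sum => i x.
by apply: (@continuous_comp _ _ _ (iter i f) phi); [exact: continuous_iter|exact: cphi].
Qed.

Lemma Rintegral_orbit_average mu phi n : invariant_measure f mu ->
  continuous phi -> (0 < n)%N ->
  \int[mu]_x orbit_average f phi x 0 n = \int[mu]_x phi x.
Proof.
move=> inv cphi n0; rewrite /orbit_average subn0.
have bi i : bounded_measurable (fun x : borel X => phi (iter i f x)).
  apply: continuous_bounded_measurable => // x.
  by apply: (@continuous_comp _ _ _ (iter i f) phi); [exact: continuous_iter|exact: cphi].
have -> : \int[mu]_x ((\sum_(0 <= i < n) phi (iter i f x)) / n%:R) =
    \int[mu]_x (n%:R^-1 * \sum_(0 <= i < n) phi (iter i f x)).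
  by apply: eq_Rintegral => x _; rewrite mulrC.
rewrite bounded_RintegralZ; last exact: bounded_measurable_sum.
rewrite bounded_Rintegral_sum// (eq_bigr (fun=> \int[mu]_x phi x)).
  by rewrite sumr_const_nat subn0 -[X in _ * X]mulr_natl mulKf// pnatr_eq0 -lt0n.
by move=> i _; exact: invariant_Rintegral_iter.
Qed.

(* The Birkhoff averages of phi cannot all be well below mu(phi) on omega_f(x);
   an orbit segment of x that starts near a good point z follows that of z. *)
Lemma exists_Vstar_ge x mu phi : continuous phi ->
  inv_measures f (omega_limit f x) mu ->
  exists2 nu, Vstar_f f x nu & \int[mu]_y phi y <= \int[nu]_y phi y.
Proof.
move=> cphi [inv muO]; apply: contrapT => nV.
set c := \int[mu]_y phi y in nV.
have [|c' c'c [n _ nc']] := @empirical_cluster_lt _ _ compactX f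
    long_intervals _ long_intervals_lt x phi c cphi.
  move=> nu Vnu; rewrite ltNge; apply/negP => h; apply: nV; exists nu => //.
  by rewrite Vstar_fE.
(* The averages have mu-integral c, so on the omega-limit set they cannot all be at most the
   midpoint of c' and c. The length n.+1 keeps the interval nonempty when n = 0. *)
have [z [oz cz]] : exists z, omega_limit f x z /\
    (c' + c) / 2 < orbit_average f phi z 0 n.+1.
  apply: contrapT => nz.
  suff : c <= (c' + c) / 2 by lra.
  apply: (@le_trans _ _ (\int[mu]_z orbit_average f phi z 0 n.+1)).
    by rewrite Rintegral_orbit_average.
  apply: (@bounded_le_Rintegral_full _ _ _ mu _ (omega_limit f x)) => //.
  - apply: (continuous_bounded_measurable compactX).
    exact: continuous_orbit_average.
  - by apply: closed_borel_measurable; exact: closed_omega_limit.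
  - by move=> z oz; rewrite leNgt; apply/negP => cz; apply: nz; exists z.
have [m _ /=] := @omega_limit_recurrent x z _ 0 oz (open_nbhs_nbhs
  (conj (open_gt_continuous ((c' + c) / 2)
    (@continuous_orbit_average phi n.+1 cphi)) cz)).
have := nc' (m, (m + n.+1)%N); rewrite /= addKn => /(_ (leqnSn n)).
by rewrite orbit_average_shift; lra.
Qed.

End LongIntervals.

(** * Existence of ergodic measures *)

Section ConditionalProbabilities.
Context d (T : measurableType d) (R : realType).

Lemma conditional_probability (nu : probability T R) (B : set T) (b : R) :
  measurable B -> nu B = b%:E -> 0 < b ->
  exists P : probability T R,
    forall C, measurable C -> nu (C `&` B) = (b%:E * P C)%E.
Proof.
move=> mB nuB b0; pose m : {measure set T -> \bar R} := mrestr nu mB.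
exists (mnormalize m nu) => C mC.
have mT : m setT = b%:E by rewrite /m /= /mrestr setTI.
change (m C = (b%:E * mnormalize m nu C)%E).
rewrite /mnormalize mT eqe gt_eqF//= muleC -muleA -EFinM mulVf ?gt_eqF//.
by rewrite mule1.
Qed.

(** The hypotheses say that nu is the convex combination b P + (1 - b) Q. *)
Lemma bounded_Rintegral_split (nu P Q : probability T R) (A : set T) (b : R)
    (g : T -> R) : measurable A -> 0 <= b <= 1 ->
  (forall C, measurable C -> nu (C `&` A) = (b%:E * P C)%E) ->
  (forall C, measurable C -> nu (C `&` ~` A) = ((1 - b)%:E * Q C)%E) ->
  bounded_measurable g ->
  \int[nu]_x g x = b * \int[P]_x g x + (1 - b) * \int[Q]_x g x.
Proof.
move=> mA /andP[b0 b1] nuP nuQ bg; have [mg [M gM]] := bg.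
have b1' : 0 <= 1 - b by rewrite subr_ge0.
have ge0 (h : T -> R) : bounded_measurable h -> (forall x, 0 <= h x) ->
    \int[nu]_x h x = b * \int[P]_x h x + (1 - b) * \int[Q]_x h x.
  move=> bh h0; have mh : measurable_fun setT (EFin \o h).
    by apply/measurable_EFinP; case: bh.
  have intE (mu : probability T R) :
      (\int[mu]_x h x)%:E = (\int[mu]_x (h x)%:E)%E.
    rewrite /Rintegral fineK//.
    exact: integrable_fin_num (bounded_measurable_integrable _ bh).
  apply: EFin_inj; rewrite EFinD !EFinM !intE.
  rewrite (@eq_measure_integral _ _ _ setT
    (measure_add (mscale (NngNum b0) P) (mscale (NngNum b1') Q))); last first.
    move=> C mC _; rewrite [RHS]measure_addE /= /mscale /= -nuP// -nuQ//.
    rewrite -measureU; last 3 first.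
    - exact: measurableI.
    - by apply: measurableI => //; exact: measurableC.
    - by rewrite setIACA setICr setI0.
    by rewrite -setIUr setUCr setIT.
  rewrite ge0_integral_measure_add//; last by move=> x _; rewrite lee_fin.
  by rewrite !ge0_integral_mscale// => x _; rewrite lee_fin.
have bc (c : R) : bounded_measurable (cst c : T -> R).
  exact: bounded_measurable_cst.
have := ge0 (fun x => g x + M); rewrite !bounded_RintegralD//; try exact: bc.
rewrite !Rintegral_cst_prob => e; apply: (addIr M); rewrite e.
- ring.
- by apply: bounded_measurableD => //; exact: bc.
- by move=> x; have := gM x; rewrite ler_norml; lra.
Qed.

End ConditionalProbabilities.

Section ErgodicMeasures.
Context (R : realType) (X : pmetricType R) (f : X -> X).
Hypothesis compactX : compact [set: X].
Hypothesis cf : continuous f.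
Implicit Types (phi psi : X -> R) (mu nu : probability (borel X) R) (x y z : X).

(** Both conditions are equalities between integrals of continuous functions. *)
Lemma closed_inv_measures (Y : set X) : closed Y ->
  closed (inv_measures f Y : set (weak_star X)).
Proof.
move=> cY; have [psi [cpsi psi0 psiY]] := closed_zero_set cY.
have YE : Y = [set y | psi y = 0] by apply/seteqP; split => y /psiY.
have cphif phi : continuous phi -> continuous (fun y => phi (f y)).
  by move=> cphi y; apply: (@continuous_comp _ _ _ f phi); [exact: cf|exact: cphi].
rewrite (_ : inv_measures f Y =
  [set mu : weak_star X | \int[mu : probability (borel X) R]_x psi x = 0] `&`
  \bigcap_(phi in [set phi : X -> R | continuous phi])
    [set mu : weak_star X | \int[mu : probability (borel X) R]_x phi (f x) =
      \int[mu : probability (borel X) R]_x phi x]); last first.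
  apply/seteqP; split => mu.
    move=> [inv muY]; split.
      by apply/(measure_zero_set compactX) => //; rewrite -YE.
    move=> phi /= cphi; apply: invariant_Rintegral => //.
    exact: continuous_bounded_measurable.
  move=> [/= int0 inv]; split; first exact: invariant_measure_continuous.
  by rewrite YE; apply/(measure_zero_set compactX).
apply: closedI.
  by apply: closed_eq_continuous; [exact: continuous_integral|exact: cst_continuous].
apply: closed_bigI => phi /= cphi; apply: closed_eq_continuous.
  exact: (continuous_integral (cphif phi cphi)).
exact: continuous_integral.
Qed.

Section Lexicographic.
Variables (K0 : set (weak_star X)) (g : nat -> X -> R).
Hypothesis K0_closed : closed K0.
Hypothesis K0_nonempty : K0 !=set0.
Hypothesis g_continuous : forall j, continuous (g j).

Let I (j : nat) (mu : weak_star X) : R :=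
  \int[mu : probability (borel X) R]_x g j x.

Fixpoint lex_max (j : nat) : set (weak_star X) :=
  if j is j'.+1
  then [set mu | lex_max j' mu /\ forall nu, lex_max j' nu -> I j' nu <= I j' mu]
  else K0.

(** The successive sets of maximizers are nonempty, closed and decreasing in a compact space. *)
Lemma lex_max_meet : exists mu, forall j, lex_max j mu.
Proof.
have cI j : continuous (I j) by exact: continuous_integral.
have closedL j : closed (lex_max j).
  elim: j => [//|j ih] /=.
  rewrite (_ : mkset _ = lex_max j `&`
    \bigcap_(nu in lex_max j) [set mu | I j nu <= I j mu]); last first.
    by apply/seteqP; split => mu [h1 h2]; split => // nu; exact: h2.
  by apply: closedI => //; apply: closed_bigI => nu _; exact: closed_ge_continuous.
have L0 j : lex_max j !=set0.
  elim: j => [//|j ih].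
  have cL : compact (lex_max j).
    exact: subclosed_compact (closedL j) (compact_weak_star compactX) _.
  have [mu Lmu maxmu] := compact_max_continuous cL ih (cI j).
  by exists mu; split.
have decr m n : (m <= n)%N -> lex_max n `<=` lex_max m.
  elim: n => [|n ih]; first by rewrite leqn0 => /eqP ->.
  by rewrite leq_eqVlt => /predU1P[->//|/ih h] mu [/h].
have [m Lm] := choice L0.
have [mu [_ clmu]] := compact_weak_star compactX _
  (@filterT _ (m @ \oo) _).
exists mu => j; apply: closedL => B muB; apply: clmu => //.
by exists j => // n jn; exact: decr (Lm n).
Qed.

End Lexicographic.

(* The maximizers of phi in the compact convex set [inv_measures f Y] form a
   face; maximizing a separating family of functions lexicographically in that
   face singles out an extreme point, and extreme points are ergodic. *)
Lemma exists_ergodic_ge (Y : set X) mu phi : closed Y -> continuous phi ->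
  inv_measures f Y mu ->
  exists2 nu, erg_measures f Y nu & \int[mu]_y phi y <= \int[nu]_y phi y.
Proof.
move=> cY cphi Ymu.
have [psi [cpsi psi0 psiY]] := closed_zero_set cY.
have YE : Y = [set y | psi y = 0] by apply/seteqP; split => y /psiY.
have [p [cp sep]] := countable_separating_family compactX.
(* Putting phi first makes nu a maximizer of phi; the separating functions then break the remaining
   ties. *)
pose g j := if j is j'.+1 then p j' else phi.
have cg j : continuous (g j) by case: j.
have bg j := continuous_bounded_measurable compactX (cg j).
have [nu Lnu] := @lex_max_meet (inv_measures f Y) g (closed_inv_measures cY)
  (ex_intro _ mu Ymu) cg.
have [inv nuY] := Lnu 0%N.
exists nu; last by have [_] := Lnu 1%N; apply.
split => //; split => // A mA fA.
have [b nuA] : exists b : R, nu A = b%:E.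
  by exists (fine (nu A)); rewrite fineK// fin_num_measure.
have b0 : 0 <= b by rewrite -lee_fin -nuA.
have b1 : b <= 1 by rewrite -lee_fin -nuA probability_le1.
have [bE|bn0] := eqVneq b 0; first by left; rewrite nuA bE.
have [bE|bn1] := eqVneq b 1; first by right; rewrite nuA bE.
have {bn0} b0' : 0 < b by rewrite lt_neqAle eq_sym bn0.
have {bn1} b1' : b < 1 by rewrite lt_neqAle bn1.
have mA' := measurableC mA.
have nuA' : nu (~` A) = (1 - b)%:E by rewrite probability_setC// nuA.
(* An invariant set of measure b strictly between 0 and 1 would split nu into its conditional
   measures on A and on the complement. *)
have [P nuP] := conditional_probability mA nuA b0'.
have [|Q nuQ] := conditional_probability mA' nuA'; first by rewrite subr_gt0.
have split_int := bounded_Rintegral_split mA _ nuP nuQ.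
have {}split_int h : bounded_measurable h ->
    \int[nu]_x h x = b * \int[P]_x h x + (1 - b) * \int[Q]_x h x.
  by apply: split_int; rewrite b0 b1.
have mf := continuous_borel_measurable_self cf.
have cond_inv (c : R) (B : set (borel X)) (S : probability (borel X) R) : 0 < c ->
    measurable B -> f @^-1` B = B ->
    (forall C, measurable C -> nu (C `&` B) = (c%:E * S C)%E) -> invariant_measure f S.
  move=> c0 mB fB nuS C mC.
  have mfC : measurable (f @^-1` C : set (borel X)) by rewrite -[_ @^-1` _]setTI; exact: mf.
  have : (c%:E * S (f @^-1` C) = c%:E * S C)%E.
    rewrite -!nuS// -[in LHS]fB -preimage_setI inv//.
    exact: measurableI.
  move/(congr1 (fun t => (c^-1%:E * t)%E)).
  by rewrite !muleA -!EFinM mulVf ?gt_eqF// !mul1e.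
(* Faces: the integrals against P and Q are at most the maximum, and their weighted mean with
   positive weights equals it, so both attain it. *)
have Lpq j : lex_max (inv_measures f Y) g j P /\ lex_max (inv_measures f Y) g j Q.
  elim: j => [|j [LP LQ]].
    have bpsi := continuous_bounded_measurable compactX cpsi.
    have := split_int psi bpsi.
    have -> : \int[nu]_x psi x = 0.
      by apply/(measure_zero_set compactX) => //; rewrite -YE.
    have P0 : 0 <= \int[P]_x psi x by exact: Rintegral_ge0.
    have Q0 : 0 <= \int[Q]_x psi x by exact: Rintegral_ge0.
    have bP0 := mulr_ge0 b0 P0.
    have bQ0 : 0 <= (1 - b) * \int[Q]_x psi x by rewrite mulr_ge0// subr_ge0.
    move=> e; have : b * \int[P]_x psi x = 0 by lra.
    have : (1 - b) * \int[Q]_x psi x = 0 by lra.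
    move=> /eqP; rewrite mulf_eq0 subr_eq0 gt_eqF//= => /eqP Q00.
    move=> /eqP; rewrite mulf_eq0 gt_eqF//= => /eqP P00.
    split; split.
    - exact: cond_inv mA fA nuP.
    - by rewrite YE; apply/(measure_zero_set compactX).
    - apply: cond_inv mA' _ nuQ; first by rewrite subr_gt0.
      by rewrite -preimage_setC fA.
    - by rewrite YE; apply/(measure_zero_set compactX).
  have [_ nuM] := Lnu j.+1.
  have Ple := nuM _ LP; have Qle := nuM _ LQ.
  have := split_int _ (bg j) => e.
  have PE : \int[P]_x g j x = \int[nu]_x g j x.
    apply/eqP; rewrite eq_le Ple /= -(ler_pM2l b0').
    have : (1 - b) * \int[Q]_x g j x <= (1 - b) * \int[nu]_x g j x.
      by rewrite ler_wpM2l// subr_ge0.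
    by rewrite mulrBl; lra.
  have QE : \int[Q]_x g j x = \int[nu]_x g j x.
    have c0 : 0 < 1 - b by rewrite subr_gt0.
    apply: (mulfI (lt0r_neq0 c0)); by move: e; rewrite PE; lra.
  by split; split => //= la /nuM; rewrite ?PE ?QE.
(* P and nu agree on the separating family, hence are equal. Then b = nu A = b P A = b^2, which
   excludes 0 < b < 1. *)
have PA : P A = nu A.
  apply: (continuous_Rintegral_inj compactX) => // h ch.
  apply/eqP; rewrite -subr_eq0 -normr_eq0; apply/eqP/le_anti.
  rewrite normr_ge0 andbT; apply/ler_addgt0Pr => e e0; rewrite add0r.
  have [N [c [c0 Nc]]] := sep h ch e e0.
  apply: Nc => j _; have [_ Pmax] := (Lpq j.+2).1; have [_ nuM] := Lnu j.+2.
  have -> : \int[P]_x p j x = \int[nu]_x p j x.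
    apply/eqP; rewrite eq_le.
    by rewrite (nuM _ (Lpq j.+1).1) (Pmax _ (Lnu j.+1)).
  by rewrite subrr normr0 ltW.
have := nuP _ mA; rewrite setIid PA nuA -EFinM => -[bb].
have : b * (1 - b) = 0 by rewrite mulrBr mulr1 -bb subrr.
by move/eqP; rewrite mulf_eq0 subr_eq0 gt_eqF//= gt_eqF.
Qed.

End ErgodicMeasures.

(** * Positive frequency of returns *)

Section PositiveReturnFrequency.
Context (R : realType) (X : pmetricType R) (f : X -> X).
Hypothesis cf : continuous f.
Variable mu : probability (borel X) R.
Hypothesis inv : invariant_measure f mu.

Let mf := continuous_borel_measurable_self cf.

Section MaximalInequality.
Variable g : borel X -> R.
Hypothesis bg : bounded_measurable g.

(* [max_sum n x] is the maximum of 0 and the Birkhoff sums of g at x of length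
   at most n. *)
Fixpoint max_sum (n : nat) : borel X -> R :=
  if n is n'.+1 then fun x => Num.max 0 (g x + max_sum n' (f x)) else fun=> 0.

Lemma bounded_measurable_max_sum n : bounded_measurable (max_sum n).
Proof.
elim: n => [|n ih] /=; first exact: bounded_measurable_cst.
apply: bounded_measurable_max; first exact: bounded_measurable_cst.
apply: bounded_measurableD => //.
exact: (bounded_measurable_comp mf ih).
Qed.

Lemma max_sum_ge0 n x : 0 <= max_sum n x.
Proof. by case: n => [|n] //=; rewrite le_max lexx. Qed.

Lemma max_sumS n x : max_sum n x <= max_sum n.+1 x.
Proof.
elim: n x => [|n ih] x; first exact: max_sum_ge0.
rewrite /= ge_max !le_max lexx /=; apply/orP; right.
by rewrite lerD2l; have := ih (f x); rewrite /= .
Qed.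

Lemma birkhoff_sum_le_max_sum n x :
  \sum_(0 <= i < n) g (iter i f x) <= max_sum n x.
Proof.
elim: n x => [|n ih] x; first by rewrite big_geq.
rewrite big_nat_recl//= le_max; apply/orP; right; rewrite lerD2l.
by rewrite (le_trans _ (ih (f x)))//; under eq_bigr do rewrite -iterS iterSr.
Qed.

Definition max_sum_pos n : set (borel X) := [set x | 0 < max_sum n x].

Lemma measurable_max_sum_pos n : measurable (max_sum_pos n).
Proof.
have [mM _] := bounded_measurable_max_sum n.
have := mM measurableT _ (measurable_itv `]0, +oo[).
by rewrite setTI; congr measurable; apply/seteqP; split => x /=;
  rewrite in_itv /= andbT.
Qed.

(** Where [max_sum n.+1] is positive it equals g + max_sum n o f; elsewhere it is 0, at most max_sum
    n o f. After integration, invariance replaces max_sum n o f by [max_sum n], which is at most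
    [max_sum n.+1]. *)
Lemma maximal_inequality n : 0 <= \int[mu]_x (g x * \1_(max_sum_pos n.+1) x).
Proof.
have bI := bounded_measurable_indic R (measurable_max_sum_pos n.+1).
have bM := bounded_measurable_max_sum.
have bMf : bounded_measurable (fun x : borel X => max_sum n (f x)).
  exact: (bounded_measurable_comp mf (bM n)).
have bgI := bounded_measurableM bg bI.
have : \int[mu]_x max_sum n.+1 x <=
    \int[mu]_x (g x * \1_(max_sum_pos n.+1) x + max_sum n (f x)).
  apply: bounded_le_Rintegral => [||x]; first exact: bM.
    exact: bounded_measurableD.
  rewrite indicE; case: (boolP (x \in _)) => [|/negP xE].
    rewrite inE /max_sum_pos /= lt_max ltxx /= mulr1 => gt0.
    by rewrite ge_max lexx ltW.
  rewrite mulr0 add0r (le_trans _ (max_sum_ge0 n (f x)))// leNgt; apply/negP => h.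
  by apply: xE; exact: mem_set.
rewrite bounded_RintegralD// (invariant_Rintegral cf inv (bM n)).
have : \int[mu]_x max_sum n x <= \int[mu]_x max_sum n.+1 x.
  by apply: bounded_le_Rintegral => [||x]; [exact: bM|exact: bM|exact: max_sumS].
lra.
Qed.

End MaximalInequality.

Variable A : set (borel X).
Hypothesis mA : measurable A.

Definition return_count n x : R := \sum_(0 <= i < n) \1_A (iter i f x).

(** The points whose visits to A have lower density 0, written with countable quantifiers and no
    limit, so that measurability and invariance are elementary. *)
Definition zero_return_frequency : set (borel X) :=
  [set x | forall k N : nat,
    exists2 n, (N <= n)%N & k%:R * return_count n x < n%:R].

Local Notation D := zero_return_frequency.

Lemma return_countS n x : return_count n.+1 x = \1_A x + return_count n (f x).
Proof.
rewrite /return_count big_nat_recl//=; congr (_ + _).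
by under eq_bigr do rewrite -iterS iterSr.
Qed.

Lemma return_count_ge0 n x : 0 <= return_count n x.
Proof. by apply: sumr_ge0 => i _; rewrite indicE. Qed.

Lemma zero_return_frequency_invariant : f @^-1` D = D.
Proof.
have ind01 x : 0 <= (\1_A x : R) <= 1.
  by rewrite indicE; case: (_ \in _); rewrite lexx ler01.
apply/seteqP; split => x /= Dx k N.
  (* A shift changes the count by at most 1 and the time by 1; using 2k instead of k, at times n >=
     2k, absorbs this. *)
  have [n] := Dx (2 * k)%N (maxn N (2 * k)).
  rewrite geq_max => /andP[Nn kn] h; exists n.+1; first exact: leqW.
  have := ind01 x; have := return_count_ge0 n (f x); rewrite return_countS.
  rewrite natrM in h; have : (2 * k)%N%:R <= n%:R :> R by rewrite ler_nat.
  rewrite natrM => k2 T0 /andP[i0 i1].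
  have : k%:R * \1_A x <= k%:R * 1 :> R by rewrite ler_wpM2l.
  by rewrite mulrDr mulr1 -natr1; lra.
have [[//|n]] := Dx (2 * k)%N N.+2.
rewrite ltnS => Nn; rewrite return_countS natrM => h; exists n; first exact: ltnW.
have /andP[i0 i1] := ind01 x; have := return_count_ge0 n (f x) => T0.
have : 0 <= k%:R * \1_A x :> R by rewrite mulr_ge0.
have : 1 <= n%:R :> R by rewrite ler1n (leq_trans _ Nn).
by move: h; rewrite mulrDr -natr1; lra.
Qed.

Lemma bounded_measurable_return_count n :
  bounded_measurable (return_count n : borel X -> R).
Proof.
apply: bounded_measurable_sum => i.
have mi : measurable_fun setT (iter i f : borel X -> borel X).
  elim: i => [|i ih]; first exact: measurable_id.
  exact: (measurableT_comp mf ih).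
exact: (bounded_measurable_comp mi (bounded_measurable_indic R mA)).
Qed.

Lemma measurable_zero_return_frequency : measurable D.
Proof.
have -> : D = \bigcap_k \bigcap_N \bigcup_n
    (if (N <= n)%N then [set x | k%:R * return_count n x < n%:R] else set0).
  apply/seteqP; split => x.
    by move=> Dx k _ N _; have [n Nn h] := Dx k N; exists n => //; rewrite Nn.
  by move=> Dx k N; have [n _] := Dx k I N I; case: ifP => // Nn h; exists n.
apply: bigcapT_measurable => k; apply: bigcapT_measurable => N.
apply: bigcupT_measurable => n; case: ifP => // _.
have [mT _] := bounded_measurableZ k%:R (bounded_measurable_return_count n).
have := mT measurableT _ (measurable_itv `]-oo, n%:R[).
by rewrite setTI; congr measurable; apply/seteqP; split => x /=; rewrite in_itv.
Qed.

(* Apply the maximal inequality to (e - 1_A) 1_D: some Birkhoff sum is positive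
   at each point of D, and all of them vanish off D. *)
Lemma measure_zero_return_frequency_le (e : R) : 0 < e -> (mu (A `&` D) <= e%:E)%E.
Proof.
move=> e0; have mD := measurable_zero_return_frequency.
have bA := bounded_measurable_indic R mA; have bD := bounded_measurable_indic R mD.
pose g (x : borel X) : R := (e - \1_A x) * \1_D x.
have bg : bounded_measurable g.
  apply: bounded_measurableM => //; apply: bounded_measurableB => //.
  exact: bounded_measurable_cst.
have Df x : D (f x) <-> D x by rewrite -[in X in _ <-> X]zero_return_frequency_invariant.
have Diter i x : D (iter i f x) <-> D x.
  by elim: i => //= i ih; rewrite Df.
have off n x : ~ D x -> max_sum g n x = 0.
  elim: n x => //= n ih x nDx; rewrite ih; last by rewrite Df.
  by rewrite /g [X in _ * X]indicE memNset// mulr0 addr0; exact/max_idPl.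
pose E n := max_sum_pos g n.+1.
have mE n : measurable (E n) by exact: measurable_max_sum_pos.
have ED n : E n `<=` D.
  move=> x Ex; apply: contrapT => nDx.
  by have : 0 < max_sum g n.+1 x := Ex; rewrite off// ltxx.
have DE : A `&` D = \bigcup_n (A `&` E n).
  apply/seteqP; split => [x [Ax Dx]|x [n _ [Ax /ED]]//].
  (* With k >= 1/e, a point of D has fewer than e n returns by some time n >= 1, so the Birkhoff sum
     of e - 1_A is positive there. *)
  have [k ke] : exists k : nat, e^-1 <= k%:R.
    by exists (Num.truncn e^-1).+1; rewrite ltW// truncnS_gt.
  have [[//|n] _ h] := Dx k 1%N; exists n => //; split => //.
  rewrite /E /max_sum_pos /= -/(max_sum g n.+1 x).
  apply: lt_le_trans (birkhoff_sum_le_max_sum g n.+1 x).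
  rewrite (eq_bigr (fun i => e - \1_A (iter i f x))); last first.
    by move=> i _; rewrite /g [X in _ * X]indicE mem_set ?mulr1//; exact/Diter.
  rewrite sumrB sumr_const_nat subn0 -/(return_count n.+1 x) subr_gt0.
  have T0 := return_count_ge0 n.+1 x.
  rewrite -mulr_natr -ltr_pdivrMl// (le_lt_trans _ h)// ler_wpM2r//.
have cvgE : (mu (A `&` E n) @[n --> \oo] --> mu (A `&` D))%E.
  rewrite DE; apply: nondecreasing_cvg_mu.
  - by move=> n; exact: measurableI.
  - by apply: bigcupT_measurable => n; exact: measurableI.
  - apply/nondecreasing_seqP => n; apply/subsetPset; apply: setIS => x.
    by rewrite /E /max_sum_pos => /lt_le_trans; apply; exact: max_sumS.
rewrite -(cvg_lim (@ereal_hausdorff R) cvgE).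
apply: lime_le; first by apply/cvg_ex; exists (mu (A `&` D)).
apply: nearW => n; have := maximal_inequality bg n; rewrite -/(E n).
have mAE : measurable (A `&` E n) by exact: measurableI.
have bAE := bounded_measurable_indic R mAE.
have bE := bounded_measurable_indic R (mE n).
(* As E n lies in D, the factor 1_D disappears, and the maximal inequality reads mu(A [&] E n) <= e
   mu(E n) <= e. *)
have -> : \int[mu]_x (g x * \1_(E n) x) =
    \int[mu]_x (e * \1_(E n) x - \1_(A `&` E n) x).
  apply: eq_Rintegral => x _; rewrite /g !indicE in_setI.
  case: (boolP (x \in E n)) => [|_]; last by rewrite andbF !mulr0 subr0.
  by rewrite inE => /ED Dx; rewrite (mem_set Dx) andbT !mulr1.
rewrite bounded_RintegralB//; last exact: bounded_measurableZ.
rewrite bounded_RintegralZ// subr_ge0 -Rintegral_indicE// lee_fin => h.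
rewrite (le_trans h)// (ler_piMr (ltW e0))// -lee_fin Rintegral_indicE//.
exact: probability_le1.
Qed.

Lemma measure_zero_return_frequency : mu (A `&` D) = 0%E.
Proof.
apply/eqP; rewrite eq_le measure_ge0 andbT; apply/lee_addgt0Pr => e e0.
by rewrite add0e; exact: measure_zero_return_frequency_le.
Qed.

End PositiveReturnFrequency.

(** * Omega-limit sets defined by densities *)

Section OmegaSets.
Context (R : realType) (X : pmetricType R) (f : X -> X).
Hypothesis compactX : compact [set: X].
Hypothesis cf : continuous f.
Implicit Types (phi : X -> R) (mu nu : probability (borel X) R) (x y z : X).

(* [V_f] is the set of cluster points of the empirical measures along this
   filter, as [Vstar_f] is along [long_intervals]. *)
Definition initial_intervals : set_system (nat * nat) :=
  (fun n : nat => (0%N, n)) @ \oo.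

Lemma initial_intervals_proper : ProperFilter initial_intervals.
Proof. exact: fmap_proper_filter. Qed.

Lemma initial_intervals_lt : \forall I \near initial_intervals, (I.1 < I.2)%N.
Proof. by exists 1%N. Qed.

Lemma V_f_sub_Vstar x : V_f f x `<=` Vstar_f f x.
Proof.
rewrite (Vstar_fE compactX cf) => mu Vmu A B [n _ nA] Bmu; apply: Vmu => //.
by exists n => // k /= nk; apply: (nA (0%N, k)); rewrite /= subn0.
Qed.

Lemma V_f_nonempty x : V_f f x !=set0.
Proof.
exact: (empirical_cluster_nonempty compactX f initial_intervals_proper).
Qed.

Lemma Vstar_f_inv x : Vstar_f f x `<=` inv_measures f (omega_limit f x).
Proof.
by rewrite (Vstar_fE compactX cf) => mu; exact: empirical_cluster_omega_limit.
Qed.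

Lemma omega_lower_densityE x : omega_density f (@lower_density R) x =
  \bigcap_(mu in V_f f x) msupport mu.
Proof.
apply/seteqP; split => y.
  move=> ldy; apply/(bigcap_msupport_frequency compactX f
    initial_intervals_proper initial_intervals_lt) => e e0.
  have /limf_einf_gt0[c c0 [V FV Vc]] := ldy e e0; exists c => //.
  exists [set I | c <= frequency R (visits f x (ball y e)) I.1 I.2] => //.
  by case: FV => n _ nV; exists n => // k /nV /Vc.
move=> /(bigcap_msupport_frequency compactX f
  initial_intervals_proper initial_intervals_lt) Sy e e0.
have [c c0 [V FV Vc]] := Sy e e0.
apply/limf_einf_gt0; exists c => //.
by exists [set n | V (0%N, n)] => // n /Vc.
Qed.

Lemma omega_upper_densityE x : omega_density f (@upper_density R) x =
  closure (\bigcup_(mu in V_f f x) msupport mu).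
Proof.
apply/seteqP; split => y.
  move=> udy; apply/(closure_bigcup_msupport_frequency compactX f
    initial_intervals_proper initial_intervals_lt) => e e0.
  have /limf_esup_gt0[c c0 cV] := udy e e0; exists c => // V FV.
  by have [n Vn cn] := cV _ FV; exists (0%N, n).
move=> /(closure_bigcup_msupport_frequency compactX f
  initial_intervals_proper initial_intervals_lt) Sy e e0.
have [c c0 cV] := Sy e e0; apply/limf_esup_gt0; exists c => // V [n _ nV].
(* The condition on I.1 belongs to the filter and ensures that the interval found starts at 0. *)
have [|[a b] /= [-> Vb] cb] := cV [set I | I.1 = 0%N /\ V I.2].
  by exists n => // k /nV.
by exists b.
Qed.

Lemma omega_lower_banachE x : omega_density f (@lower_banach_density R) x =
  \bigcap_(mu in Vstar_f f x) msupport mu.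
Proof.
rewrite (Vstar_fE compactX cf); apply/seteqP; split => y.
  move=> ldy; apply/(bigcap_msupport_frequency compactX f
    long_intervals_proper long_intervals_lt) => e e0.
  by have /limf_einf_gt0 := ldy e e0.
move=> /(bigcap_msupport_frequency compactX f
  long_intervals_proper long_intervals_lt) Sy e e0.
by apply/limf_einf_gt0; exact: Sy.
Qed.

Lemma omega_upper_banachE x : omega_density f (@upper_banach_density R) x =
  closure (\bigcup_(mu in Vstar_f f x) msupport mu).
Proof.
rewrite (Vstar_fE compactX cf); apply/seteqP; split => y.
  move=> udy; apply/(closure_bigcup_msupport_frequency compactX f
    long_intervals_proper long_intervals_lt) => e e0.
  by have /limf_esup_gt0 := udy e e0.
move=> /(closure_bigcup_msupport_frequency compactX f
  long_intervals_proper long_intervals_lt) Sy e e0.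
by apply/limf_esup_gt0; exact: Sy.
Qed.

(** * Families of measures compared through integrals *)

Definition integral_dominated (A B : set (probability (borel X) R)) : Prop :=
  forall mu phi, continuous phi -> A mu ->
    exists2 nu, B nu & \int[mu]_x phi x <= \int[nu]_x phi x.

(** Domination of the negated tent bounds the tent integral of mu from below by that of some nu in
    B. *)
Lemma bigcap_msupport_dominated (A B : set (probability (borel X) R)) :
  integral_dominated A B ->
  \bigcap_(nu in B) msupport nu `<=` \bigcap_(mu in A) msupport mu.
Proof.
move=> AB y By mu Amu; apply/(msupport_tent compactX) => e e0.
have [nu Bnu] := AB mu _ (continuous_funN (@continuous_tent _ _ y e)) Amu.
rewrite !bounded_RintegralN; try exact: bounded_measurable_tent.
rewrite lerN2; apply: lt_le_trans.
by have /(msupport_tent compactX) := By _ Bnu; exact.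
Qed.

Lemma closure_msupport_dominated (A B : set (probability (borel X) R)) :
  integral_dominated A B ->
  closure (\bigcup_(mu in A) msupport mu) `<=`
  closure (\bigcup_(nu in B) msupport nu).
Proof.
move=> AB y /(closure_msupport_tent compactX) Ay.
apply/(closure_msupport_tent compactX) => e e0; have [mu Amu mu0] := Ay e e0.
have [nu Bnu munu] := AB mu _ (@continuous_tent _ _ y e) Amu.
by exists nu => //; exact: lt_le_trans munu.
Qed.

Lemma sub_integral_dominated (A B : set (probability (borel X) R)) :
  A `<=` B -> integral_dominated A B.
Proof. by move=> AB mu phi _ /AB Bmu; exists mu. Qed.

Lemma inv_measures_dominated_Vstar x :
  integral_dominated (inv_measures f (omega_limit f x)) (Vstar_f f x).
Proof. by move=> mu phi cphi; exact: exists_Vstar_ge. Qed.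

Lemma inv_measures_dominated_erg (Y : set X) : closed Y ->
  integral_dominated (inv_measures f Y) (erg_measures f Y).
Proof. by move=> cY mu phi cphi; exact: exists_ergodic_ge. Qed.

Lemma erg_measures_sub_inv (Y : set X) : erg_measures f Y `<=` inv_measures f Y.
Proof. by move=> mu [[inv _] muY]. Qed.

Lemma closed_bigcap_msupport (A : set (probability (borel X) R)) :
  closed (\bigcap_(mu in A) msupport mu).
Proof. by apply: closed_bigI => mu _; exact: closed_msupport. Qed.

Lemma invariant_bigcap_msupport (A : set (probability (borel X) R)) :
  (forall mu, A mu -> invariant_measure f mu) ->
  invariant_set f (\bigcap_(mu in A) msupport mu).
Proof.
move=> invA _ [y Sy <-] mu Amu.
by apply: (invariant_msupport cf (invA _ Amu)); exists y => //; exact: Sy.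
Qed.

Lemma invariant_set_iter (Z : set X) z n : invariant_set f Z -> Z z ->
  Z (iter n f z).
Proof. by move=> fZ Zz; elim: n => //= n ih; apply: fZ; exists (iter n f z). Qed.

Lemma probability1_subset mu (Y Z : set X) : closed Y -> closed Z -> Y `<=` Z ->
  mu Y = 1%E -> mu Z = 1%E.
Proof.
move=> cY cZ YZ muY; apply/le_anti/andP; split.
  by apply: probability_le1; exact: closed_borel_measurable.
by rewrite -muY; apply: le_measure => //; rewrite inE; exact: closed_borel_measurable.
Qed.

(** Any limit of empirical measures of a point of Z is carried by the omega-limit set of that point,
    which lies in Z. *)
Lemma exists_invariant_measure (Z : set X) : Z !=set0 -> closed Z ->
  invariant_set f Z -> inv_measures f Z !=set0.
Proof.
move=> [z Zz] cZ fZ; have [mu Vmu] := V_f_nonempty z.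
have [inv muO] := Vstar_f_inv (V_f_sub_Vstar Vmu); exists mu; split => //.
have oZ : omega_limit f z `<=` Z.
  move=> y oy; apply: cZ => B By; have [k _ Bk] := omega_limit_recurrent 0 oy By.
  by exists (iter k f z); split => //; exact: invariant_set_iter.
by apply: probability1_subset muO => //; exact: closed_omega_limit.
Qed.

(** A nonempty closed invariant Z inside the set carries an invariant measure. Being carried by the
    omega-limit set of x, this measure has a support containing the intersection of all supports,
    and this support lies in Z. *)
Lemma minimal_omega_lower_banach x :
  omega_density f (@lower_banach_density R) x !=set0 ->
  minimal f (omega_density f (@lower_banach_density R) x).
Proof.
rewrite omega_lower_banachE => K0.
have KM : \bigcap_(mu in Vstar_f f x) msupport mu `<=`
    \bigcap_(mu in inv_measures f (omega_limit f x)) msupport mu.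
  exact: bigcap_msupport_dominated (@inv_measures_dominated_Vstar x).
have Ko : \bigcap_(mu in Vstar_f f x) msupport mu `<=` omega_limit f x.
  have [mu Vmu] := V_f_nonempty x; have {}Vmu := V_f_sub_Vstar Vmu.
  move=> y /(_ _ Vmu); apply: msupport_sub; first exact: closed_omega_limit.
  by have [] := Vstar_f_inv Vmu.
split => //.
- exact: closed_bigcap_msupport.
- by apply: invariant_bigcap_msupport => mu /Vstar_f_inv[].
- move=> Z Z0 cZ fZ ZK; apply/seteqP; split => //.
  have [mu [inv muZ]] := exists_invariant_measure Z0 cZ fZ.
  apply: subset_trans KM _ => y /(_ mu) Sy; apply: (msupport_sub cZ muZ).
  apply: Sy; split => //; apply: probability1_subset muZ => //.
    exact: closed_omega_limit.
  exact: subset_trans Ko.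
Qed.

Lemma omega_upper_banach_sub x :
  omega_density f (@upper_banach_density R) x `<=` omega_limit f x.
Proof.
rewrite omega_upper_banachE => y cly; apply: (@closed_omega_limit _ _ f x).
apply: closure_subset cly => z [mu Vmu]; apply: msupport_sub.
  exact: closed_omega_limit.
by have [] := Vstar_f_inv Vmu.
Qed.

(** Each set is contained in the next, from the lower density set up to the orbit closure. The first
    is closed and invariant, so once it contains x it contains the orbit closure, and the chain
    closes up. *)
Lemma omega_eq_of_recurrent x : omega_density f (@lower_density R) x x ->
  [/\ omega_density f (@lower_density R) x = omega_density f (@upper_density R) x,
      omega_density f (@upper_density R) x =
        omega_density f (@upper_banach_density R) x,
      omega_density f (@upper_banach_density R) x = omega_limit f x &
      omega_limit f x = closure (orb f x)].
Proof.
have lu : omega_density f (@lower_density R) x `<=`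
    omega_density f (@upper_density R) x.
  rewrite omega_lower_densityE omega_upper_densityE => y Sy.
  have [mu Vmu] := V_f_nonempty x; apply: subset_closure; exists mu => //.
  exact: Sy.
have uB : omega_density f (@upper_density R) x `<=`
    omega_density f (@upper_banach_density R) x.
  rewrite omega_upper_densityE omega_upper_banachE; apply: closure_subset.
  by move=> y [mu Vmu Sy]; exists mu => //; exact: V_f_sub_Vstar.
have Bo := @omega_upper_banach_sub x.
have oo : omega_limit f x `<=` closure (orb f x).
  move=> y /(_ 1%N isT); apply: closure_subset => _ [k _ ->].
  by exists k.
move=> xx; have ol : closure (orb f x) `<=` omega_density f (@lower_density R) x.
  move: xx; rewrite omega_lower_densityE => xx y cly.
  apply: (@closed_bigcap_msupport (V_f f x)); apply: closure_subset cly => _ [n _ <-].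
  apply: invariant_set_iter xx; apply: invariant_bigcap_msupport => mu Vmu.
  by have [] := Vstar_f_inv (V_f_sub_Vstar Vmu).
split; apply/seteqP; split => //.
- by move=> y /uB /Bo /oo /ol.
- by move=> y /Bo /oo /ol /lu.
- by move=> y /oo /ol /lu /uB.
- by move=> y /ol /lu /uB /Bo.
Qed.

(** * Almost everywhere statements *)

Lemma lower_density_gt0 (A : set (borel X)) x (U : set X) :
  ~ zero_return_frequency f A x -> A `<=` U ->
  (0 < lower_density R (visits f x U))%E.
Proof.
move=> /existsNP[k /existsNP[N kN]] AU.
have nk n : (N <= n)%N -> n%:R <= k%:R * return_count f A n x :> R.
  by move=> Nn; rewrite leNgt; apply/negP => h; apply: kN; exists n.
(* For k = 0 the bound at the time [maxn N 1] would say that a positive number is at most 0. *)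
have k0 : 0 < k%:R :> R.
  rewrite ltr0n lt0n; apply/eqP => k0; have := nk (maxn N 1) (leq_maxl _ _).
  by rewrite k0 mul0r lern0; lia.
apply/limf_einf_gt0; exists k%:R^-1; first by rewrite invr_gt0.
exists [set n | (maxn N 1 <= n)%N]; first by exists (maxn N 1).
move=> n /=; rewrite geq_max => /andP[Nn n0].
rewrite frequencyE /orbit_average subn0 ler_pdivlMr ?ltr0n//.
rewrite ler_pdivrMl// (le_trans (nk n Nn))// ler_wpM2l//.
apply: ler_sum => i _; rewrite !indicE ler_nat.
case: (boolP (_ \in A)) => // /set_mem /AU AUi.
by rewrite mem_set.
Qed.

(** With a countable base a single null set suffices: off it, x returns with positive lower density
    to every basic set containing it. *)
Lemma ae_recurrent mu : invariant_measure f mu ->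
  {ae mu, forall x, omega_density f (@lower_density R) x x}.
Proof.
move=> inv; have [U [oU baseU]] := countable_open_base compactX.
have mU n := open_borel_measurable (oU n).
have : mu.-negligible (\bigcup_n (U n `&` zero_return_frequency f (U n))).
  apply: negligible_bigcup => n; apply/negligibleP.
    by apply: measurableI => //; exact: measurable_zero_return_frequency.
  exact: (measure_zero_return_frequency cf inv (mU n)).
apply: negligibleS => x nx.
apply: contrapT => nU; apply: nx => e e0.
have [n Unx Ue] := baseU x _ (open_nbhs_nbhs (open_nbhs_mball x e0)).
apply: (@lower_density_gt0 (U n)) Ue => Dx.
by apply: nU; exists n.
Qed.

(** The points visiting a basic set U n with lower density 0 form an invariant set, of measure 0 or
    1; measure 1 would make U n null. So almost every orbit meets all basic sets of positive
    measure, and it stays in the closed invariant support. *)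
Lemma ae_orbit_dense mu : ergodic_measure f mu ->
  {ae mu, forall x, closure (orb f x) = msupport mu}.
Proof.
move=> [inv erg]; have [U [oU baseU]] := countable_open_base compactX.
have mU n := open_borel_measurable (oU n).
have mS := closed_borel_measurable (@closed_msupport _ _ mu).
have negS : mu.-negligible (~` msupport mu).
  apply/negligibleP; first exact: measurableC.
  by rewrite /= probability_setC// msupport_full// subee.
have : mu.-negligible (~` msupport mu `|`
    \bigcup_n (if mu (U n) == 0%E then set0 else zero_return_frequency f (U n))).
  apply: negligibleU => //; apply: negligible_bigcup => n.
  case: ifPn => [_|U0]; first exact: negligible_set0.
  have mD := measurable_zero_return_frequency cf (mU n).
  apply/negligibleP => //.
  have [//|D1] := erg _ mD (zero_return_frequency_invariant f (U n)).
  case/eqP: U0; rewrite -(measure_zero_return_frequency cf inv (mU n)).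
  have D0 : mu (~` zero_return_frequency f (U n)) = 0%E.
    by rewrite probability_setC// D1 subee.
  rewrite [LHS](measureDI mu (mU n) mD) [X in (X + _)%E](_ : _ = 0%E) ?add0e//.
  apply/eqP; rewrite eq_le measure_ge0 andbT -D0; apply: le_measure; rewrite ?inE//.
    exact: measurableD.
  exact: measurableC.
apply: negligibleS => x nx; apply: contrapT => /not_orP[/contrapT Sx nU]; apply: nx.
apply/seteqP; split => y.
  move=> cly; apply: (@closed_msupport _ _ mu); apply: closure_subset cly => _ [n _ <-].
  by apply: invariant_set_iter Sx; exact: invariant_msupport.
move=> Sy B By; have [n Uny UB] := baseU y B By.
have U0 : mu (U n) == 0%E = false.
  by apply/negbTE; rewrite gt_eqF//; apply: Sy.
have nD : ~ zero_return_frequency f (U n) x.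
  by move=> Dx; apply: nU; exists n => //; rewrite U0.
have := lower_density_gt0 nD (@subset_refl _ (U n)).
move=> /limf_einf_gt0[c c0 [V [N _ NV] Vc]].
have := Vc _ (NV N (leqnn N)).
have [[k Uk]|nk] := pselect (exists k, U n (iter k f x)).
  by move=> _; exists (iter k f x); split; [exists k|exact: UB].
rewrite frequencyE /orbit_average big1 ?mul0r => [|i _]; first by lra.
by rewrite indicE memNset// => Ui; apply: nk; exists i.
Qed.

End OmegaSets.

Theorem theorem1p3 (R : realType) (X : pmetricType R) (f : X -> X)
    (compactX : compact [set: X]) (cf : continuous f) :
  let omega_ld := omega_density f (@lower_density R) in
  let omega_ud := omega_density f (@upper_density R) in
  let omega_lB := omega_density f (@lower_banach_density R) in
  let omega_uB := omega_density f (@upper_banach_density R) in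
  [/\ (* (1) *)
      forall x : X, omega_ld x = \bigcap_(mu in V_f f x) msupport mu,
      (* (2) *)
      forall x : X,
        omega_ud x = closure (\bigcup_(mu in V_f f x) msupport mu) /\
        closure (\bigcup_(mu in V_f f x) msupport mu) !=set0,
      (* (3) *)
      forall x : X,
        [/\ omega_lB x = \bigcap_(mu in Vstar_f f x) msupport mu,
            \bigcap_(mu in Vstar_f f x) msupport mu =
              \bigcap_(mu in inv_measures f (omega_limit f x)) msupport mu,
            \bigcap_(mu in inv_measures f (omega_limit f x)) msupport mu =
              \bigcap_(mu in erg_measures f (omega_limit f x)) msupport mu &
            omega_lB x !=set0 -> minimal f (omega_lB x)],
      (* (4) *)
      forall x : X,
        [/\ omega_uB x = closure (\bigcup_(mu in Vstar_f f x) msupport mu),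
            closure (\bigcup_(mu in Vstar_f f x) msupport mu) =
              closure (\bigcup_(mu in inv_measures f (omega_limit f x))
                         msupport mu),
            closure (\bigcup_(mu in inv_measures f (omega_limit f x))
                       msupport mu) =
              closure (\bigcup_(mu in erg_measures f (omega_limit f x))
                         msupport mu) &
            closure (\bigcup_(mu in erg_measures f (omega_limit f x))
                       msupport mu) !=set0] &
      (* (5) *)
      forall mu : probability (borel X) R,
        (invariant_measure f mu ->
          {ae mu, forall x : X,
            [/\ omega_ld x = omega_ud x, omega_ud x = omega_uB x,
                omega_uB x = omega_limit f x &
                omega_limit f x = closure (orb f x)]}) /\
        (ergodic_measure f mu ->
          {ae mu, forall x : X,
            [/\ omega_ld x = omega_ud x, omega_ud x = omega_uB x,
                omega_uB x = omega_limit f x,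
                omega_limit f x = closure (orb f x) &
                closure (orb f x) = msupport mu]})].
Proof.
move=> omega_ld omega_ud omega_lB omega_uB.
have Mo x := Vstar_f_inv compactX cf (x := x).
have cO x := @closed_omega_limit _ _ f x.
split.
- exact: omega_lower_densityE.
- move=> x; split; first exact: omega_upper_densityE.
  have [mu Vmu] := V_f_nonempty f compactX x.
  have [y Sy] := msupport_nonempty compactX mu.
  by exists y; apply: subset_closure; exists mu.
- move=> x; split.
  + exact: omega_lower_banachE.
  + apply/seteqP; split; apply: (bigcap_msupport_dominated compactX).
      exact: inv_measures_dominated_Vstar.
    exact: sub_integral_dominated.
  + apply/seteqP; split; apply: (bigcap_msupport_dominated compactX).
      by apply: sub_integral_dominated; exact: erg_measures_sub_inv.
    exact: inv_measures_dominated_erg.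
  + exact: minimal_omega_lower_banach.
- move=> x; split.
  + exact: omega_upper_banachE.
  + apply/seteqP; split; apply: (closure_msupport_dominated compactX).
      exact: sub_integral_dominated.
    exact: inv_measures_dominated_Vstar.
  + apply/seteqP; split; apply: (closure_msupport_dominated compactX).
      exact: inv_measures_dominated_erg.
    by apply: sub_integral_dominated; exact: erg_measures_sub_inv.
  + have [mu Vmu] := V_f_nonempty f compactX x.
    have Mmu := Mo _ _ (V_f_sub_Vstar compactX cf Vmu).
    (* Maximizing the zero function, [exists_ergodic_ge] merely asserts that an ergodic measure
       exists. *)
    have c0 : continuous (fun _ : X => 0 : R) by exact: cst_continuous.
    have [nu Enu _] := exists_ergodic_ge compactX cf (cO x) c0 Mmu.
    have [y Sy] := msupport_nonempty compactX nu.
    by exists y; apply: subset_closure; exists nu.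
- move=> mu; split => [inv|erg].
    have := ae_recurrent compactX cf inv; apply: negligibleS => x nx rec.
    by apply: nx; exact: omega_eq_of_recurrent.
  have := negligibleU (ae_recurrent compactX cf erg.1)
    (ae_orbit_dense compactX cf erg).
  apply: negligibleS => x nx; apply: contrapT => /not_orP[/contrapT rec].
  move=> /contrapT dense; apply: nx.
  have {}rec : omega_density f (@lower_density R) x x by exact: rec.
  have [ld_ud ud_uB uB_omega omega_orb] := omega_eq_of_recurrent compactX cf rec.
  exact: And5 ld_ud ud_uB uB_omega omega_orb dense.
Qed.
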